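(* Let $\nu_{K,h}$ be the quasi-best-approximation constant, with respect to $\|\cdot\|$, of the nonlinear variational discretization (defined in the context). Assume that there is $\bar\mu\ge1$ with $\mu_h\le\bar\mu$ for all $h$, and set $$\bar\kappa=\frac{1+2L}{1+L}\left(1+M\left(1+\frac{2M}{\sqrt{\alpha}}\right)\bar\mu\right),\qquad L=\frac{M}{\sqrt{\alpha}} .$$ If $I:V_1\to W$ and $C:Q\to V_2^*$ are compact and $\lim_{h\to0}\inf_{v_h\in V_h}\|v-v_h\|=0$ for every $v\in V$, then $$\nu_{K,h}\le\mu_h\left(1+\frac{M}{\sqrt{\alpha}}\,\bar\kappa\,o(1)\right)\quad\text{as }h\to0.$$ More specifically, if conditions (Q1)--(Q4) of the context hold with some $\delta>0$, then $$\nu_{K,h}\le\mu_h\left(1+\frac{M}{\sqrt{\alpha}}\,\bar\kappa\,O(h^\delta)\right)\quad\text{as }h\to0.$$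
   Context: Let $Q, W, V_1, V_2$ be real Hilbert spaces with norms $\|\cdot\|_Q,\|\cdot\|_W,\|\cdot\|_1,\|\cdot\|_2$; $\langle\cdot,\cdot\rangle_i$ denotes the duality pairing of $V_i^*$ and $V_i$. Let $a:V_1\times V_2\to\mathbb{R}$ be a bounded bilinear form such that, for all $v_1\in V_1$, if $a(v_1,v_2)=0$ for all $v_2\in V_2$, then $v_1=0$, and $\inf_{\|v_2\|_2=1}\sup_{\|v_1\|_1=1}a(v_1,v_2)>0$. The norm of $V_2$ is (after replacing it, if necessary, by an equivalent one) $\|v_2\|_2=\sup_{\varphi_1\in V_1,\ \|\varphi_1\|_1=1}a(\varphi_1,v_2)$, so that the continuity and inf-sup constants of $a$ are both $1$. Let $A:V_1\to V_2^*$, $Av_1=a(v_1,\cdot)$, and $A^*:V_2\to V_1^*$, $A^*v_2=a(\cdot,v_2)$; both are boundedly invertible, and $A^{-*}:=(A^* )^{-1}$. Let $C:Q\to V_2^*$ and $I:V_1\to W$ be bounded linear operators with operator norms $M_C$ and $M_I$, $C^*:V_2\to Q$ given by $(q,C^*v_2)_Q=\langle Cq,v_2\rangle_2$, and $M:=\max\{M_I,M_C\}$. Let $\alpha>0$. Let $K\subset Q$ be nonempty, closed and convex, and let $\Pi_K:Q\to K$ be the metric projection onto $K$. Set $V:=V_1\times V_2$ with $\|v\|:=(\|v_1\|_1^2+\|v_2\|_2^2)^{1/2}$ and, for $v,\varphi\in V$, $$b_K(v,\varphi):=a(v_1,\varphi_2)+a(\varphi_1,v_2)-\big(\Pi_K(-\tfrac{1}{\sqrt{\alpha}}C^*v_2),C^*\varphi_2\big)_Q-\tfrac{1}{\sqrt{\alpha}}(Iv_1,I\varphi_1)_W.$$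 Let $h$ range over a sequence of positive numbers tending to $0$. For each $h$, let $V_{h,i}\subset V_i$, $i=1,2$, be finite-dimensional subspaces such that the restriction of $a$ to $V_{h,1}\times V_{h,2}$ is nondegenerate (no nonzero element of either space is annihilated by the whole other space), and $V_h:=V_{h,1}\times V_{h,2}$. The generalized Ritz projection $R_{h,1}:V_1\to V_{h,1}$ is given by $a(R_{h,1}v_1,\varphi_{h,2})=a(v_1,\varphi_{h,2})$ for all $\varphi_{h,2}\in V_{h,2}$. The quasi-best-approximation constant $\mu_h$ of the constraint discretization is the smallest number $\mu_h\ge1$ such that $\|v_1-R_{h,1}v_1\|_1\le\mu_h\inf_{v_{h,1}\in V_{h,1}}\|v_1-v_{h,1}\|_1$ for all $v_1\in V_1$. For $u_d\in W$, let $x\in V$ be the (unique) solution of $b_K(x,\varphi)=-\tfrac{1}{\sqrt{\alpha}}(u_d,I\varphi_1)_W$ for all $\varphi\in V$, and let $x_h\in V_h$ be the (unique) solution of $b_K(x_h,\varphi_h)=-\tfrac{1}{\sqrt{\alpha}}(u_d,I\varphi_{h,1})_W$ for all $\varphi_h\in V_h$ (the nonlinear variational discretization). The constant $\nu_{K,h}$ is the smallest number $\nu_{K,h}\ge1$ such that $\|x-x_h\|\le\nu_{K,h}\inf_{v_h\in V_h}\|x-v_h\|$ for all $u_d\in W$. Sobolev spaces: fix a domain; for $s\ge0$ let $H^s$ be the Sobolev space over it with norm $\|\cdot\|_{H^s}$, and for $s<0$ let $H^s$ be the dual of $H^{-s}$ with the dual norm. With $L^2=H^0$ as pivot space, $H^t\subset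 H^s$ for $t\ge s$, and $H^{-s}$ is identified with the dual of $H^s$ for every real $s$; elements of $H^{-s_i}$ act on a subspace $V_i\subset H^{s_i}$ by restriction. (Q1) There are $s_1,s_2\in\mathbb{R}$ and $C_S\ge1$ such that, for $i=1,2$, $V_i$ is a closed subspace of $H^{s_i}$ and $C_S^{-1}\|\cdot\|_{H^{s_i}}\le\|\cdot\|_i\le C_S\|\cdot\|_{H^{s_i}}$ on $V_i$. (Q2) $C\in L(Q,H^{-s_2+\delta})$ and $I\in L(H^{s_1-\delta},W)$, i.e. $C$ maps boundedly into $H^{-s_2+\delta}$ and $I$ extends to a bounded operator on $H^{s_1-\delta}$. (Q3) There is $C_R>0$ such that $\|A^{-1}f\|_{H^{s_1+\delta}}\le C_R\|f\|_{H^{-s_2+\delta}}$ for all $f\in H^{-s_2+\delta}$ and $\|A^{-*}g\|_{H^{s_2+\delta}}\le C_R\|g\|_{H^{-s_1+\delta}}$ for all $g\in H^{-s_1+\delta}$. (Q4) There is $C_{\mathcal I}>0$ such that, for all $h$ and all $v=(v_1,v_2)\in V$ with $v_i\in H^{s_i+\delta}$, $\inf_{v_h\in V_h}\|v-v_h\|\le C_{\mathcal I}h^\delta\big(\|v_1\|_{H^{s_1+\delta}}^2+\|v_2\|_{H^{s_2+\delta}}^2\big)^{1/2}$. *)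

(* Defs.v *)
From HB Require Import structures.
From mathcomp Require Import all_boot all_order all_algebra.
From mathcomp Require Import all_classical all_reals all_analysis.

Set Implicit Arguments.
Unset Strict Implicit.
Unset Printing Implicit Defensive.

Import Order.TTheory GRing.Theory Num.Theory.
Import numFieldNormedType.Exports.

Local Open Scope classical_set_scope.
Local Open Scope ring_scope.

HB.mixin Record isHilbert (R : realType) V & CompleteNormedModule R V := {
  dot : V -> V -> R;
  dotC : forall u v, dot u v = dot v u;
  dotP : forall (c : R) u v w, dot (c *: u + v) w = c * dot u w + dot v w;
  dotvv : forall u, dot u u = `|u| ^+ 2
}.

#[short(type="hilbertType")]
HB.structure Definition Hilbert (R : realType) :=
  {V of isHilbert R V & CompleteNormedModule R V}.

Section normed_dual.
Variables (R : realType) (V : normedModType R).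

Definition blf : {pred V -> R} := fun f =>
  `[< (forall (c : R) u v, f (c *: u + v) = c * f u + f v) /\
      exists c, forall v, `|f v| <= c * `|v| >].

Lemma blf_submod_closed : submod_closed blf.
Proof.
split=> [|k f g /asboolP[fl [c fc]] /asboolP[gl [d gd]]]; apply/asboolP.
  split=> [c u v|]; first by rewrite /= mulr0 addr0.
  by exists 0 => v; rewrite mul0r normr0.
split=> [a u v|].
  change (k * f (a *: u + v) + g (a *: u + v) =
          a * (k * f u + g u) + (k * f v + g v)).
  by rewrite fl gl !mulrDr !addrA [k * (a * _)]mulrCA -!addrA; congr (_ + _);
     rewrite addrCA.
exists (`|k| * c + d) => v; rewrite mulrDl.
apply: (le_trans (ler_normD _ _)); apply: lerD; last exact: gd.
change (`|k * f v| <= `|k| * c * `|v|).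
by rewrite normrM -mulrA ler_wpM2l.
Qed.

HB.instance Definition _ :=
  GRing.isSubmodClosed.Build R (V -> R) blf blf_submod_closed.

Record dual := Dual { dual_val :> V -> R; dualP : dual_val \in blf }.

HB.instance Definition _ := [isSub for dual_val].
HB.instance Definition _ := [Choice of dual by <:].
HB.instance Definition _ := [SubChoice_isSubLmodule of dual by <:].

Definition dual_norm (f : dual) : R :=
  sup [set `|f v| | v in [set v | `|v| <= 1]].

Lemma dual_norm_has_sup (f : dual) :
  has_sup [set `|f v| | v in [set v | `|v| <= 1]].
Proof.
have /asboolP[fl [c fc]] := dualP f.
split; first by exists `|f 0|, 0 => //=; rewrite normr0.
exists `|c| => _ [v /= v1 <-]; apply: (le_trans (fc v)).
apply: (le_trans (ler_wpM2r (normr_ge0 v) (ler_norm c))).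
by rewrite -[leRHS]mulr1 ler_wpM2l.
Qed.

Lemma dual_norm_ub (f : dual) v : `|v| <= 1 -> `|f v| <= dual_norm f.
Proof. by move=> v1; apply: sup_upper_bound; [exact: dual_norm_has_sup|exists v]. Qed.

Lemma dual_norm_le (f : dual) (c : R) :
  (forall v, `|v| <= 1 -> `|f v| <= c) -> dual_norm f <= c.
Proof.
move=> fc; apply: ge_sup; first by case: (dual_norm_has_sup f).
by move=> _ [v /= v1 <-]; exact: fc.
Qed.

Lemma dual_normD (f g : dual) : dual_norm (f + g) <= dual_norm f + dual_norm g.
Proof.
apply: dual_norm_le => v v1; apply: (le_trans (ler_normD (f v) (g v))).
by apply: lerD; exact: dual_norm_ub.
Qed.

Lemma dual_normZ (k : R) (f : dual) : dual_norm (k *: f) = `|k| * dual_norm f.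
Proof.
have leZ (l : R) (g : dual) : dual_norm (l *: g) <= `|l| * dual_norm g.
  apply: dual_norm_le => v v1; change (`|l * g v| <= `|l| * dual_norm g).
  by rewrite normrM ler_wpM2l// dual_norm_ub.
apply/eqP; rewrite eq_le leZ /=.
have [->|k0] := eqVneq k 0.
  rewrite normr0 mul0r; apply: (le_trans (normr_ge0 ((0 *: f : dual) 0))).
  by apply: dual_norm_ub; rewrite normr0.
rewrite -[in leLHS](scale1r f) -(mulVf k0) -scalerA.
apply: (le_trans (ler_wpM2l (normr_ge0 k) (leZ k^-1 (k *: f)))).
by rewrite normfV mulrA divff ?mul1r// normr_eq0.
Qed.

Lemma dual_norm0_eq0 (f : dual) : dual_norm f = 0 -> f = 0.
Proof.
move=> f0; apply/val_inj/funext => v; change (f v = 0).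
have /asboolP[fl _] := dualP f.
have fz : f 0 = 0.
  by have := fl 1 0 0; rewrite scaler0 addr0 mul1r => /eqP;
     rewrite -subr_eq0 opprD addNKr oppr_eq0 => /eqP.
have [->//|v0] := eqVneq v 0.
have : `|f (`|v|^-1 *: v)| <= 0.
  by rewrite -f0; apply: dual_norm_ub; rewrite normrZ normfV normr_id mulVf ?normr_eq0.
rewrite normr_le0 -[_ *: _]addr0 fl fz addr0 mulf_eq0 invr_eq0 normr_eq0.
by rewrite (negbTE v0) => /eqP.
Qed.

HB.instance Definition _ :=
  Lmodule_isNormed.Build R dual dual_normD dual_normZ dual_norm0_eq0.

End normed_dual.

Section operators.
Variables (R : realType) (U V : normedModType R).

Definition opnorm (T : U -> V) : R :=
  sup [set `|T u| | u in [set u | `|u| <= 1]].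

Definition compact_operator (T : U -> V) : Prop :=
  compact (closure (T @` [set u | `|u| <= 1])).

Definition bounded_bilinear (a : U -> V -> R) : Prop :=
  [/\ forall (c : R) u u' v, a (c *: u + u') v = c * a u v + a u' v,
      forall (c : R) u v v', a u (c *: v + v') = c * a u v + a u v' &
      exists c, forall u v, `|a u v| <= c * `|u| * `|v|].

Definition findim_subspace (S : set V) : Prop :=
  exists n (e : 'I_n -> V), S = range (fun c : 'I_n -> R => \sum_i c i *: e i).

Definition is_metric_proj (K : set V) (P : V -> V) : Prop :=
  forall q, K (P q) /\ forall k, K k -> `|q - P q| <= `|q - k|.

Definition dist_to (S : set V) (v : V) : R := inf [set `|v - w| | w in S].

End operators.

(* The library norm on a product is the maximum norm. *)
Definition l2norm (R : realType) (U V : normedModType R) (v : U * V) : R :=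
  Num.sqrt (`|v.1| ^+ 2 + `|v.2| ^+ 2).

Definition l2dist (R : realType) (U V : normedModType R) (S : set (U * V))
    (v : U * V) : R :=
  inf [set l2norm (v - w) | w in S].

(* The smallest c >= 1 with P c, and +oo when there is none; the infimum is
   attained when P is a closed condition on c, as it is below. *)
Definition best_const (R : realType) (P : R -> Prop) : \bar R :=
  ereal_inf [set c%:E | c in [set c | 1 <= c /\ P c]].

Definition nondegenerate_on (R : realType) (V1 V2 : normedModType R)
    (a : V1 -> V2 -> R) (S1 : set V1) (S2 : set V2) : Prop :=
  (forall v1, S1 v1 -> (forall v2, S2 v2 -> a v1 v2 = 0) -> v1 = 0) /\
  (forall v2, S2 v2 -> (forall v1, S1 v1 -> a v1 v2 = 0) -> v2 = 0).

Section control_problem.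
Variables (R : realType) (Q W V1 V2 : hilbertType R).
Variables (a : V1 -> V2 -> R) (Cs : V2 -> Q) (I : V1 -> W) (PK : Q -> Q).
Variable alpha : R.

Definition bK (v phi : V1 * V2) : R :=
  a v.1 phi.2 + a phi.1 v.2
  - dot (PK (- (Num.sqrt alpha)^-1 *: Cs v.2)) (Cs phi.2)
  - (Num.sqrt alpha)^-1 * dot (I v.1) (I phi.1).

Definition solves (S : set (V1 * V2)) (ud : W) (x : V1 * V2) : Prop :=
  S x /\ forall phi, S phi ->
    bK x phi = - (Num.sqrt alpha)^-1 * dot ud (I phi.1).

Definition is_ritz (Vh1 : set V1) (Vh2 : set V2) (Rh : V1 -> V1) : Prop :=
  forall v1, Vh1 (Rh v1) /\ forall phi2, Vh2 phi2 -> a (Rh v1) phi2 = a v1 phi2.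

Definition ritz_const (Vh1 : set V1) (Rh : V1 -> V1) : \bar R :=
  best_const (fun c => forall v1, `|v1 - Rh v1| <= c * dist_to Vh1 v1).

Definition discr_const (Vh : set (V1 * V2)) : \bar R :=
  best_const (fun c => forall ud x xh, solves setT ud x -> solves Vh ud xh ->
    l2norm (x - xh) <= c * l2dist Vh x).

End control_problem.

Definition linear_on (R : realType) (X Y : lmodType R) (D : set X)
    (T : X -> Y) : Prop :=
  forall (c : R) u v, D u -> D v -> T (c *: u + v) = c *: T u + T v.

Section seminormed_dual.
Variables (R : realType) (X : lmodType R) (D : set X) (N : X -> R).

Definition in_dual (F : X -> R) : Prop :=
  linear_on D (F : X -> R^o) /\ exists c, forall u, D u -> `|F u| <= c * N u.

Definition in_dual_norm (F : X -> R) : R :=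
  sup [set `|F u| | u in [set u | D u /\ N u <= 1]].
End seminormed_dual.

Section sobolev.
Variables (R : realType) (d : nat).
Local Notation pt := 'rV[R]_d.

Definition tuple_pt n (t : n.-tuple (measurableTypeR R)) : 'rV[R]_n :=
  \row_i tnth t i.

(* d-dimensional Lebesgue measure as an iterated product. *)
Fixpoint leb n : set (n.-tuple (measurableTypeR R)) -> \bar R :=
  match n with
  | 0 => \d_([tuple])
  | n'.+1 => pushforward (@lebesgue_measure R \x @leb n')%E
      (fun p : measurableTypeR R * n'.-tuple (measurableTypeR R) =>
         [tuple of p.1 :: p.2])
  end.

Variable Om : set pt.
Local Notation OmT := (@tuple_pt d @^-1` Om).

(* Integral over Om; d.-tuple R carries the measurable structure, 'rV[R]_d the
   topological one. *)
Definition intg (f : pt -> \bar R) : \bar R :=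
  (\int[@leb d]_(t in OmT) f (tuple_pt t))%E.

Definition L2dot (f g : pt -> R) : R := fine (intg (fun x => (f x * g x)%:E)).

Definition L2sq (f : pt -> R) : \bar R := intg (fun x => (f x ^+ 2)%:E).

Definition L2 (f : pt -> R) : Prop :=
  measurable_fun OmT (f \o @tuple_pt d) /\ (L2sq f < +oo)%E.

Definition partial (i : 'I_d) (f : pt -> R) : pt -> R :=
  fun x => 'D_(delta_mx 0 i) f x.

Definition smooth (f : pt -> R) : Prop :=
  forall s : seq 'I_d, let g := foldr partial f s in
    continuous g /\ forall i x, derivable g x (delta_mx 0 i).

Definition test_fun (phi : pt -> R) : Prop :=
  [/\ smooth phi, compact (closure [set x | phi x != 0]) &
      closure [set x | phi x != 0] `<=` Om].

Definition multi_index k := {ffun 'I_d -> 'I_k.+1}.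
Definition order k (al : multi_index k) : nat := (\sum_i al i)%N.
Definition mpartial k (al : multi_index k) (f : pt -> R) : pt -> R :=
  foldr (fun i g => iter (al i) (partial i) g) f (enum 'I_d).

Definition weak_deriv k (al : multi_index k) (f g : pt -> R) : Prop :=
  forall phi, test_fun phi ->
    L2dot f (mpartial al phi) = (-1) ^+ order al * L2dot g phi.

Definition weak_derivs k (f : pt -> R) (G : multi_index k -> pt -> R) : Prop :=
  forall al, (order al <= k)%N -> L2 (G al) /\ weak_deriv al f (G al).

Definition enorm (x : pt) : R := Num.sqrt (\sum_i x 0 i ^+ 2).

(* The square of the Sobolev-Slobodeckij seminorm; the integrand is 0 for
   x = y, since 0 `^ p = 0 for p > 0 and division by 0 gives 0. *)
Definition gagliardo (sg : R) (g : pt -> R) : \bar R :=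
  intg (fun x => intg (fun y =>
    ((g x - g y) ^+ 2 / enorm (x - y) `^ (d%:R + 2 * sg))%:E)).

Definition energy (s : R) k (G : multi_index k -> pt -> R) : \bar R :=
  (\sum_(al | (order al <= k)%N) L2sq (G al) +
   (if s == k%:R then 0 else
      \sum_(al | order al == k) gagliardo (s - k%:R) (G al)))%E.

(* For 0 <= s the squared norm of f in the Sobolev-Slobodeckij space of order s
   over Om; the weak derivatives are unique almost everywhere, so that the
   infimum runs over at most one value, and it is +oo if f is not in the
   space. *)
Definition sobolev_sq (s : R) (f : pt -> R) : \bar R :=
  ereal_inf [set energy s G | G in @weak_derivs (Num.truncn s) f].

Definition sobolev (s : R) (f : pt -> R) : Prop :=
  L2 f /\ (sobolev_sq s f < +oo)%E.

Definition sobolev_norm (s : R) (f : pt -> R) : R :=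
  Num.sqrt (fine (sobolev_sq s f)).

(* The whole scale H^s, s real, lives in one ambient vector space of
   functionals u on functions: for s < 0 the values of u on sobolev (- s)
   matter, for s >= 0 (where u is a function, acting through the L2 pairing of
   the pivot space) its values on L2.  The inclusion of H^t into H^s for t >= s
   is then the restriction of functionals, and leaves u unchanged. *)
Definition gfun := (pt -> R) -> R.

Definition acts_as (u : gfun) (f : pt -> R) : Prop :=
  forall phi, L2 phi -> u phi = L2dot f phi.

Definition H (s : R) (u : gfun) : Prop :=
  if s < 0 then in_dual (sobolev (- s)) (sobolev_norm (- s)) u
  else exists2 f, sobolev s f & acts_as u f.

Definition Hnorm (s : R) (u : gfun) : R :=
  if s < 0 then in_dual_norm (sobolev (- s)) (sobolev_norm (- s)) u
  else inf [set sobolev_norm s f | f in [set f | sobolev s f /\ acts_as u f]].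

Definition Heq (s : R) (u v : gfun) : Prop :=
  forall phi, sobolev (Num.max 0 (- s)) phi -> u phi = v phi.

(* The space H^{-s}, identified for every real s with the dual of H^s. *)
Definition Hdual (s : R) (F : gfun -> R) : Prop := in_dual (H s) (Hnorm s) F.
Definition Hdual_norm (s : R) (F : gfun -> R) : R :=
  in_dual_norm (H s) (Hnorm s) F.

Definition sobolev_scale : Prop :=
  forall s t, s <= t -> exists c, forall u, H t u ->
    H s u /\ Hnorm s u <= c * Hnorm t u.

Definition domain : Prop := [/\ (0 < d)%N, Om !=set0, open Om & connected Om].

Section embedding.
Variables (V : normedModType R) (J : V -> gfun).

(* J realizes V as a closed subspace of H^s, with equivalent norms. *)
Definition closed_subspace_of (s CS : R) : Prop :=
  [/\ forall v, H s (J v),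
      forall (c : R) v w, Heq s (J (c *: v + w)) (c *: J v + J w),
      forall u, H s u ->
        (forall e, 0 < e -> exists v, Hnorm s (u - J v) < e) ->
        exists v, Heq s u (J v) &
      forall v, CS^-1 * Hnorm s (J v) <= `|v| <= CS * Hnorm s (J v)].

(* v, seen in H^s, is the element w of H^t. *)
Definition regular_as (s t : R) (v : V) (w : gfun) : Prop :=
  H t w /\ Heq s w (J v).
End embedding.

Section conditions.
Variables (Q W V1 V2 : hilbertType R).
Variables (J1 : V1 -> gfun) (J2 : V2 -> gfun) (s1 s2 delta : R).

Definition condQ1 : Prop := exists CS,
  [/\ 1 <= CS, closed_subspace_of J1 s1 CS & closed_subspace_of J2 s2 CS].

Definition condQ2 (C : Q -> dual V2) (I : V1 -> W) : Prop :=
  (exists Ct : Q -> gfun -> R,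
    [/\ forall q, Hdual (s2 - delta) (Ct q),
        forall (c : R) q q' u, H (s2 - delta) u ->
          Ct (c *: q + q') u = c * Ct q u + Ct q' u,
        exists c, forall q, Hdual_norm (s2 - delta) (Ct q) <= c * `|q| &
        forall q v2, C q v2 = Ct q (J2 v2)]) /\
  (exists It : gfun -> W,
    [/\ linear_on (H (s1 - delta)) It,
        exists c, forall u, H (s1 - delta) u ->
          `|It u| <= c * Hnorm (s1 - delta) u &
        forall v1, I v1 = It (J1 v1)]).

Definition condQ3 (a : V1 -> V2 -> R) : Prop := exists CR,
  [/\ 0 < CR,
      forall F, Hdual (s2 - delta) F ->
      forall v1, (forall v2, a v1 v2 = F (J2 v2)) ->
        exists2 w, regular_as J1 s1 (s1 + delta) v1 w &
          Hnorm (s1 + delta) w <= CR * Hdual_norm (s2 - delta) F &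
      forall G, Hdual (s1 - delta) G ->
      forall v2, (forall v1, a v1 v2 = G (J1 v1)) ->
        exists2 w, regular_as J2 s2 (s2 + delta) v2 w &
          Hnorm (s2 + delta) w <= CR * Hdual_norm (s1 - delta) G].

Definition condQ4 (h : nat -> R) (Vh : nat -> set (V1 * V2)) : Prop :=
  exists CI, 0 < CI /\ forall n v w1 w2,
    regular_as J1 s1 (s1 + delta) v.1 w1 ->
    regular_as J2 s2 (s2 + delta) v.2 w2 ->
    l2dist (Vh n) v <= CI * h n `^ delta *
      Num.sqrt (Hnorm (s1 + delta) w1 ^+ 2 + Hnorm (s2 + delta) w2 ^+ 2).

End conditions.
End sobolev.

(* Main.v *)
Require Import Defs.
From HB Require Import structures.
From mathcomp Require Import all_boot all_order all_algebra.
From mathcomp Require Import all_classical all_reals all_analysis.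
From mathcomp Require Import ring lra.

Set Implicit Arguments.
Unset Strict Implicit.
Unset Printing Implicit Defensive.

Import Order.TTheory GRing.Theory Num.Theory.
Import numFieldNormedType.Exports.

Local Open Scope classical_set_scope.
Local Open Scope ring_scope.

(* Write x = (u, z), beta = 1 / sqrt alpha, and let R2 be the adjoint of the
   Ritz projection R1 with respect to a; it maps V2 onto the discrete space
   and, since a is an isometric pairing, it is quasi-optimal with the same
   constant mu_h as R1.  Subtracting the discrete from the continuous equations
   and testing with the discrete errors R1 u - u_h and R2 z - z_h, the firm
   nonexpansiveness of the projection onto K bounds the errors u - u_h and
   z - z_h, measured through I and through the controls, by
   I (u - R1 u) and C* (z - R2 z).  Stability of the Ritz projections then
   gives |R x - x_h| <= (1 + mu_h) M beta eta_h |x - R x| whenever I and C* have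
   norm at most eta_h on the ranges of 1 - R1 and 1 - R2.  By duality
   (Aubin-Nitsche) eta_h is governed by the best approximation of the
   solutions of the linear adjoint and state problems with data in the images
   of I* and C; it tends to 0 in the compact case, by compactness of the images
   of the unit balls, and is O(h^delta) under (Q1)-(Q4). *)

(** * Hilbert spaces *)

Section hilbert.
Variables (R : realType) (V : hilbertType R).
Implicit Types u v w : V.

Lemma dotDl u v w : dot (u + v) w = dot u w + dot v w.
Proof. by have := dotP 1 u v w; rewrite scale1r mul1r. Qed.

Lemma dot0l w : dot 0 w = 0.
Proof. by apply: (@addrI _ (dot 0 w)); rewrite -dotDl !addr0. Qed.

Lemma dotZl (c : R) u w : dot (c *: u) w = c * dot u w.
Proof. by have := dotP c u 0 w; rewrite dot0l !addr0. Qed.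

Lemma dotNl u w : dot (- u) w = - dot u w.
Proof. by rewrite -scaleN1r dotZl mulN1r. Qed.

Lemma dotBl u v w : dot (u - v) w = dot u w - dot v w.
Proof. by rewrite dotDl dotNl. Qed.

Lemma dotDr u v w : dot w (u + v) = dot w u + dot w v.
Proof. by rewrite dotC dotDl !(dotC w). Qed.

Lemma dot0r w : dot w 0 = 0.
Proof. by rewrite dotC dot0l. Qed.

Lemma dotZr (c : R) u w : dot w (c *: u) = c * dot w u.
Proof. by rewrite dotC dotZl (dotC w). Qed.

Lemma dotNr u w : dot w (- u) = - dot w u.
Proof. by rewrite dotC dotNl (dotC w). Qed.

Lemma dotBr u v w : dot w (u - v) = dot w u - dot w v.
Proof. by rewrite dotDr dotNr. Qed.

Lemma dot_eq0 u : (forall v, dot v u = 0) -> u = 0.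
Proof.
by move=> /(_ u); rewrite dotvv => /eqP; rewrite sqrf_eq0 normr_eq0 => /eqP.
Qed.

Lemma dot_inj u u' : (forall v, dot v u = dot v u') -> u = u'.
Proof.
move=> uu'; apply/eqP; rewrite -subr_eq0; apply/eqP/dot_eq0 => v.
by rewrite dotBr uu' subrr.
Qed.

Lemma sqr_normD u v : `|u + v| ^+ 2 = `|u| ^+ 2 + 2 * dot u v + `|v| ^+ 2.
Proof. by rewrite -!dotvv dotDl !dotDr (dotC v u); ring. Qed.

Lemma dot_le u v : dot u v <= `|u| * `|v|.
Proof.
have := ler_normD u v.
rewrite -(@ler_pXn2r _ 2) ?nnegrE ?addr_ge0// sqr_normD sqrrD.
by rewrite lerD2r lerD2l -(mulr_natl (_ * _)) ler_pM2l// ltr0n.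
Qed.

Lemma normr_dot_le u v : `|dot u v| <= `|u| * `|v|.
Proof. by rewrite ler_norml dot_le andbT lerNl -dotNl -(normrN u) dot_le. Qed.

(** A minimizing sequence of [|v|^2 - 2 f v] is Cauchy by the parallelogram identity. Its
    approximate stationarity passes to the limit, which therefore represents [f]. *)
Lemma riesz (f : V -> R) (c : R) :
  (forall (k : R) u v, f (k *: u + v) = k * f u + f v) ->
  (forall v, `|f v| <= c * `|v|) -> exists w, forall v, f v = dot v w.
Proof.
move=> fP fc.
pose J v : R := `|v| ^+ 2 - 2 * f v.
have hJ : has_inf (range J).
  split; first by exists (J 0), 0.
  exists (- c ^+ 2) => _ [v _ <-]; rewrite /J.
  have := sqr_ge0 (`|v| - c); have := fc v; have := ler_norm (f v); nra.
set m := inf (range J).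
have mJ v : m <= J v by apply: ge_inf; [exact: hJ.2|exists v].
have /choice[x xP] (n : nat) : exists x, J x < m + n.+1%:R^-1.
  by have [_ [v _ <-] ?] := @inf_adherent _ _ n.+1%:R^-1 (harmonic_gt0 n) hJ; exists v.
have fZ k v : f (k *: v) = k * f v.
  have f0 : f 0 = 0.
    by have := fP 1 0 0; rewrite scaler0 addr0 mul1r; lra.
  by rewrite -[k *: v]addr0 fP f0 addr0.
have fD u v : f (u + v) = f u + f v by rewrite -[u]scale1r fP mul1r scale1r.
(* At the midpoint of [u] and [v] the value of [J] is still at least [m]; the parallelogram identity
   turns this into a distance bound. *)
have midJ u v : `|u - v| ^+ 2 <= 2 * (J u - m) + 2 * (J v - m).
  have := mJ (2^-1 *: (u + v)); rewrite /J fZ fD normrZ exprMn.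
  rewrite sqr_normD (sqr_normD u) normrN dotNr ger0_norm//; lra.
have cx : cvg (x @ \oo).
  apply/cauchy_cvgP/cauchy_exP => e e0.
  (* Once both excesses of [J] over [m] are below [e^2 / 4], [midJ] puts the squared distance below
     [e^2]. *)
  have e4 : 0 < e ^+ 2 / 4 by rewrite divr_gt0// exprn_gt0.
  have [N _ NP] := near_infty_natSinv_lt (PosNum e4).
  exists (x N); exists N => // n /= Nn; rewrite -ball_normE /=.
  rewrite -(@ltr_pXn2r _ 2) ?nnegrE// ?ltW//; apply: le_lt_trans (midJ _ _) _.
  have NP' k : (N <= k)%N -> k.+1%:R^-1 < e ^+ 2 / 4 := NP k.
  have := xP N; have := xP n; have := NP' _ (leqnn N); have := NP' _ Nn.
  move: (J (x N)) (J (x n)) N.+1%:R^-1 n.+1%:R^-1 => A B C D; lra.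
pose w := lim (x @ \oo); exists w => v.
have xw : x @ \oo --> w := cx.
have key e : 0 < e -> `|f v - dot v w| <= e * (2 * `|v|).
  move=> e0; have e2 : 0 < e ^+ 2 by rewrite exprn_gt0.
  near \oo => n.
  have s2 : (dot v (x n) - f v) ^+ 2 <= n.+1%:R^-1 * `|v| ^+ 2.
    have [->|v0] := eqVneq v 0.
      have -> : f 0 = 0 by rewrite -(scale0r 0) fZ mul0r.
      by rewrite dot0l subrr normr0 !expr0n mulr0.
    have nv : 0 < `|v| ^+ 2 by rewrite exprn_gt0// normr_gt0.
    (* Minimizing [J] along [v] from [x n] takes the coefficient [- s / q] and lowers [J] by
       [s^2 / q], which cannot exceed the excess of [J (x n)] over [m]. *)
    set s := _ - _; set q := `|v| ^+ 2; rewrite -/q in nv.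
    have := mJ (x n + (- (s / q)) *: v); have := xP n.
    rewrite /J fD fZ sqr_normD normrZ exprMn real_normK ?num_real// -/q.
    rewrite dotZr (dotC _ v) (_ : dot v (x n) = s + f v); last by rewrite /s subrK.
    move=> h1 h2; have h3 : s / q * s < n.+1%:R^-1.
      have : (- (s / q)) ^+ 2 * q = s / q * s by field; rewrite gt_eqF.
      move: h1 h2; move: (s / q) (n.+1%:R^-1) => r d; lra.
    by rewrite expr2 -ler_pdivrMr// mulrAC ltW.
  have s1 : `|dot v (x n) - f v| <= e * `|v|.
    rewrite -(@ler_pXn2r _ 2) ?nnegrE ?mulr_ge0// ?(ltW e0)//.
    rewrite real_normK ?num_real// (le_trans s2)// exprMn ler_wpM2r ?sqr_ge0//.
    apply/ltW; near: n; exact: (near_infty_natSinv_lt (PosNum e2)).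
  have t1 : `|dot v (x n - w)| <= e * `|v|.
    rewrite (le_trans (normr_dot_le _ _))// mulrC ler_wpM2r// distrC ltW//.
    by near: n; move/cvgrPdist_lt : xw; apply.
  rewrite (_ : f v - _ = dot v (x n - w) - (dot v (x n) - f v)); last first.
    by rewrite dotBr; ring.
  by rewrite (le_trans (ler_normB _ _))//; lra.
apply/eqP; rewrite -subr_eq0 -normr_le0; apply/ler_addgt0Pl => e e0; rewrite addr0.
(* The summand [1] keeps the denominator positive when [v = 0]. *)
have v1 : 0 < 2 * `|v| + 1 by rewrite ltr_wpDl// mulr_ge0.
have := key _ (divr_gt0 e0 v1); move=> /le_trans; apply.
rewrite -mulrA ger_pMr// mulrC ler_pdivrMr// mul1r lerDl//.
Unshelve. all: by end_near.
Qed.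
End hilbert.

(** * The pairing of V1 and V2 *)

Section isomorphism.
Variables (R : realType) (V1 V2 : hilbertType R) (a : V1 -> V2 -> R).
Hypothesis ab : bounded_bilinear a.

Lemma bilinear_addl u u' v : a (u + u') v = a u v + a u' v.
Proof. by have [+ _ _] := ab => /(_ 1 u u' v); rewrite scale1r mul1r. Qed.

Lemma bilinear_addr u v v' : a u (v + v') = a u v + a u v'.
Proof. by have [_ + _] := ab => /(_ 1 u v v'); rewrite scale1r mul1r. Qed.

Lemma bilinear0l v : a 0 v = 0.
Proof. by apply: (@addrI _ (a 0 v)); rewrite -bilinear_addl !addr0. Qed.

Lemma bilinear0r u : a u 0 = 0.
Proof. by apply: (@addrI _ (a u 0)); rewrite -bilinear_addr !addr0. Qed.

Lemma bilinear_scalel c u v : a (c *: u) v = c * a u v.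
Proof. by have [+ _ _] := ab => /(_ c u 0 v); rewrite bilinear0l !addr0. Qed.

Lemma bilinear_scaler c u v : a u (c *: v) = c * a u v.
Proof. by have [_ + _] := ab => /(_ c u v 0); rewrite bilinear0r !addr0. Qed.

Lemma bilinear_subl u u' v : a (u - u') v = a u v - a u' v.
Proof. by rewrite bilinear_addl -scaleN1r bilinear_scalel mulN1r. Qed.

Lemma bilinear_subr u v v' : a u (v - v') = a u v - a u v'.
Proof. by rewrite bilinear_addr -scaleN1r bilinear_scaler mulN1r. Qed.

Hypothesis norm_V2 :
  forall v2, `|v2| = sup [set a v1 v2 | v1 in [set v1 | `|v1| = 1]].

Lemma form_le u v : a u v <= `|u| * `|v|.
Proof.
have [->|u0] := eqVneq u 0; first by rewrite bilinear0l normr0 mul0r.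
have nu : 0 < `|u| by rewrite normr_gt0.
have [_ _ [c ac]] := ab.
rewrite mulrC -ler_pdivrMr// mulrC -bilinear_scalel norm_V2; apply: sup_ubound.
  exists (c * `|v|) => _ [w /= w1 <-].
  by rewrite (le_trans (ler_norm _))// (le_trans (ac _ _))// w1 mulr1.
by exists (`|u|^-1 *: u) => //=; rewrite normrZ normfV normr_id mulVf// gt_eqF.
Qed.

Lemma normr_form_le u v : `|a u v| <= `|u| * `|v|.
Proof.
by rewrite ler_norml form_le andbT lerNl -mulN1r -bilinear_scalel scaleN1r
  -(normrN u) form_le.
Qed.

Lemma form_norm_le2 v c : 0 <= c -> (forall u, a u v <= c * `|u|) -> `|v| <= c.
Proof.
move=> c0 auv; rewrite norm_V2.
(* If [V1] has no unit vector, the supremum is over the empty set, where [sup] is [0]. *)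
have [->|A0] := eqVneq [set a v1 v | v1 in [set v1 | `|v1| = 1]] set0.
  by rewrite sup0.
apply: ge_sup; first exact/set0P.
by move=> _ [u /= u1 <-]; rewrite (le_trans (auv u))// u1 mulr1.
Qed.

Hypothesis a_inj : forall v1, (forall v2, a v1 v2 = 0) -> v1 = 0.

(* The Riesz representative of [a _ v] depends isometrically on [v]; by the
   nondegeneracy of [a] the orthogonal complement of its range is trivial. *)
Lemma form_isometry : exists B : V2 -> V1,
  [/\ forall u v, a u v = dot u (B v),
      forall v v', dot (B v) (B v') = dot v v' &
      forall u, exists v, u = B v].
Proof.
have /choice[B BP] (v : V2) : exists w, forall u, a u v = dot u w.
  apply: (@riesz _ _ (fun u => a u v) `|v|) => [c u u'|u].
    by rewrite bilinear_addl bilinear_scalel.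
  by rewrite mulrC normr_form_le.
have BD v v' : B (v + v') = B v + B v'.
  by apply: dot_inj => u; rewrite dotDr -!BP bilinear_addr.
have Bn v : `|B v| = `|v|.
  apply/eqP; rewrite eq_le; apply/andP; split.
    have [->|B0] := eqVneq (B v) 0; first by rewrite normr0.
    rewrite -(@ler_pM2l _ `|B v|) ?normr_gt0// -expr2 -dotvv.
    by rewrite -BP form_le.
  by apply: form_norm_le2 => // u; rewrite BP mulrC dot_le.
have Bdot v v' : dot (B v) (B v') = dot v v'.
  by have := Bn (v + v'); move/(congr1 (fun x => x ^+ 2)); rewrite BD !sqr_normD !Bn; lra.
exists B; split => // u.
have [c v' w|v|v vP] := @riesz _ _ (fun v => a u v) `|u|.
- by rewrite bilinear_addr bilinear_scaler.
- exact: normr_form_le.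
(* [v] represents [a u _] in [V2]; since [B] is isometric, [u - B v] is orthogonal to the whole
   range of [B]. *)
exists v; apply/eqP; rewrite -subr_eq0; apply/eqP/a_inj => w.
by rewrite BP dotBl Bdot -BP vP dotC subrr.
Qed.

(** Writing [u = B v] with [|B v| = |v|], this [v] gives [a u v = |u|^2]: the inf-sup constant is
    [1] in the first argument too. *)
Lemma form_norm_le1 u c : 0 <= c -> (forall v, a u v <= c * `|v|) -> `|u| <= c.
Proof.
have [B [aB BB Bs]] := form_isometry; have [v ->] := Bs u => c0 /(_ v).
have Bn : `|B v| = `|v|.
  by apply/eqP; rewrite -(@eqrXn2 _ 2)// -!dotvv BB.
rewrite aB dotvv Bn expr2.
have [->//|v0] := eqVneq `|v| 0.
by rewrite ler_pM2r// lt0r v0 normr_ge0.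
Qed.

(** Invertibility of [A^*]: the Riesz representative of [f] lies in the range of the isometry
    [B]. *)
Lemma form_represents1 (f : V1 -> R) (c : R) :
  (forall (k : R) u v, f (k *: u + v) = k * f u + f v) ->
  (forall v, `|f v| <= c * `|v|) -> exists v2, forall u, a u v2 = f u.
Proof.
have [B [aB _ Bs]] := form_isometry => fP fc.
have [w wP] := riesz fP fc; have [v wB] := Bs w; exists v => u.
by rewrite aB -wB wP.
Qed.

(** Invertibility of [A]: the solution is the image under [B] of the Riesz representative of [f]. *)
Lemma form_represents2 (f : V2 -> R) (c : R) :
  (forall (k : R) u v, f (k *: u + v) = k * f u + f v) ->
  (forall v, `|f v| <= c * `|v|) -> exists v1, forall v, a v1 v = f v.
Proof.
have [B [aB BB _]] := form_isometry => fP fc.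
have [w wP] := riesz fP fc; exists (B w) => v.
by rewrite aB BB dotC wP.
Qed.
End isomorphism.

(** * Ritz projections *)

Section findim.
Variables (R : realType) (V : hilbertType R).
Implicit Types S : set V.

Lemma findim_subspace0 S : findim_subspace S -> S 0.
Proof.
move=> [n [e ->]]; exists (fun=> 0) => //.
by rewrite big1// => i _; rewrite scale0r.
Qed.

Lemma findim_subspaceP S (c : R) u v :
  findim_subspace S -> S u -> S v -> S (c *: u + v).
Proof.
move=> [n [e ->]] [f _ <-] [g _ <-]; exists (fun i => c * f i + g i) => //.
rewrite scaler_sumr -big_split /=; apply: eq_bigr => i _.
by rewrite scalerDl scalerA.
Qed.

Lemma findim_subspaceB S u v : findim_subspace S -> S u -> S v -> S (u - v).
Proof.
by move=> fS Su Sv; rewrite addrC -scaleN1r; exact: findim_subspaceP.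
Qed.

(* Gram-Schmidt. *)
Lemma orthogonal_projection S : findim_subspace S ->
  forall v, exists2 p, S p & forall s, S s -> dot (v - p) s = 0.
Proof.
move=> [n [e ->]]; elim: n e => [|n IHn] e v.
  exists 0; first by exists (fun=> 0) => //; rewrite big_ord0.
  by move=> _ [c _ <-]; rewrite big_ord0 dot0r.
pose e0 i := e (widen_ord (leqnSn n) i).
have [p [c _ pE] pP] := IHn e0 v; have [q [d _ qE] qP] := IHn e0 (e ord_max).
(* [e'] is the part of the last vector orthogonal to the others and [t] the coefficient of [v] along
   it; for [e' = 0] the correction vanishes. *)
set e' := _ - q in qP; pose t := dot v e' / dot e' e'.
exists (p + t *: e').
  exists (fun i => if unlift ord_max i is Some j then c j - t * d j else t) => //.
  rewrite big_ord_recr /= unlift_none /e' scalerBr -pE -qE addrCA addrC.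
  congr (_ + _); rewrite scaler_sumr -sumrB; apply: eq_bigr => i _.
  have -> : widen_ord (leqnSn n) i = lift ord_max i.
    by apply: val_inj => /=; rewrite /bump leqNgt ltn_ord.
  by rewrite liftK scalerBl scalerA /e0; congr (_ *: e _ - _ *: e _);
    apply: val_inj => /=; rewrite /bump leqNgt ltn_ord.
move=> _ [f _ <-]; rewrite big_ord_recr /=.
have S0e' s : range (fun g : 'I_n -> R => \sum_i g i *: e0 i) s ->
    dot (v - (p + t *: e')) s = 0.
  by move=> S0s; rewrite opprD addrA dotBl dotZl (pP _ S0s) (qP _ S0s) mulr0 subr0.
rewrite dotDr dotZr S0e' ?add0r; last by exists (fun i => f (widen_ord (leqnSn n) i)).
rewrite -(subrK q (e ord_max)) -/e' dotDr (S0e' q) ?addr0; last by exists d.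
rewrite opprD addrA dotBl dotBl dotZl (dotC p) qP ?subr0; last by exists c.
have [->|e'0] := eqVneq e' 0; first by rewrite !dot0r mulr0 subr0 mulr0.
by rewrite divfK ?subrr ?mulr0// dotvv sqrf_eq0 normr_eq0.
Qed.
End findim.

Section ritz.
Variables (R : realType) (V1 V2 : hilbertType R) (a : V1 -> V2 -> R).
Hypothesis ab : bounded_bilinear a.
Hypothesis norm_V2 :
  forall v2, `|v2| = sup [set a v1 v2 | v1 in [set v1 | `|v1| = 1]].
Hypothesis a_inj : forall v1, (forall v2, a v1 v2 = 0) -> v1 = 0.
Variables (S1 : set V1) (S2 : set V2) (Rh : V1 -> V1) (m : R).
Hypotheses (fS1 : findim_subspace S1) (fS2 : findim_subspace S2).
Hypothesis nd : nondegenerate_on a S1 S2.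
Hypothesis RhP : is_ritz a S1 S2 Rh.
Hypothesis m_ge0 : 0 <= m.
Hypothesis Rh_best : forall v w, S1 w -> `|v - Rh v| <= m * `|v - w|.

Lemma ritz_uniq v w : S1 w -> (forall s, S2 s -> a w s = a v s) -> Rh v = w.
Proof.
move=> Sw wv; have [SR RP] := RhP v; apply/eqP; rewrite -subr_eq0; apply/eqP.
apply: nd.1 => [|s Ss]; first exact: findim_subspaceB.
by rewrite bilinear_subl// RP// wv// subrr.
Qed.

Lemma ritz_id w : S1 w -> Rh w = w.
Proof. by move=> Sw; apply: ritz_uniq. Qed.

Lemma ritz_linear (c : R) u v : Rh (c *: u + v) = c *: Rh u + Rh v.
Proof.
apply: ritz_uniq => [|s Ss].
  by apply: findim_subspaceP => //; exact: (RhP _).1.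
by rewrite !bilinear_addl// !bilinear_scalel// !(RhP _).2.
Qed.

Lemma ritz_dist_le v : `|v - Rh v| <= m * `|v|.
Proof. by have := Rh_best v (findim_subspace0 fS1); rewrite subr0. Qed.

Lemma ritz_norm_le v : `|Rh v| <= (1 + m) * `|v|.
Proof.
rewrite mulrDl mul1r -(subKr v (Rh v)) (le_trans (ler_normB _ _))//.
by rewrite lerD2l ritz_dist_le.
Qed.

(* The adjoint of [Rh] with respect to [a] maps into the double annihilator of
   [S2], which is [S2] itself. *)
Lemma adjoint_ritz : exists Rh2 : V2 -> V2,
  forall v2, S2 (Rh2 v2) /\ forall v1, a v1 (Rh2 v2) = a (Rh v1) v2.
Proof.
have [B [aB BB _]] := form_isometry ab norm_V2 a_inj.
suff /choice[Rh2 Rh2P] : forall v2, exists z,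
    S2 z /\ forall v1, a v1 z = a (Rh v1) v2 by exists Rh2.
move=> v.
have [c u u'|u|z zP] := form_represents1 ab norm_V2 a_inj (f := fun u => a (Rh u) v)
    (c := (1 + m) * `|v|).
- by rewrite ritz_linear bilinear_addl// bilinear_scalel.
- rewrite (le_trans (normr_form_le ab norm_V2 _ _))// mulrAC ler_wpM2r//.
  exact: ritz_norm_le.
have [p Sp pP] := orthogonal_projection fS2 z.
exists z; split => //; suff -> : z = p by [].
apply/eqP; rewrite -subr_eq0; apply/eqP.
(* [B (z - p)] pairs to [0] with [S2], so [Rh] kills it. Testing the definition of [z] with it makes
   [z - p] orthogonal to [z], and it is orthogonal to [p] already. *)
have R0 : Rh (B (z - p)) = 0.
  apply: ritz_uniq => [|s Ss]; first exact: findim_subspace0.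
  by rewrite bilinear0l// aB BB pP.
have : dot (z - p) z = 0.
  by rewrite -BB -aB zP R0 bilinear0l.
move=> /eqP; rewrite -(subr0 (dot _ z)) -{1}(pP p Sp) -dotBr dotvv sqrf_eq0 normr_eq0.
by move=> /eqP.
Qed.

Section adjoint.
Variable Rh2 : V2 -> V2.
Hypothesis Rh2P :
  forall v2, S2 (Rh2 v2) /\ forall v1, a v1 (Rh2 v2) = a (Rh v1) v2.

(** The operators [1 - Rh] and [1 - Rh2] are adjoint with respect to [a], and [u - Rh u] annihilates
    [S2], so [v] may be replaced by [v - w]; the isometric pairing then transfers the constant
    [m]. *)
Lemma adjoint_ritz_best v w : S2 w -> `|v - Rh2 v| <= m * `|v - w|.
Proof.
move=> Sw; apply: (form_norm_le2 norm_V2) => [|u]; first by rewrite mulr_ge0.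
rewrite bilinear_subr// (Rh2P v).2 -bilinear_subl//.
have -> : a (u - Rh u) v = a (u - Rh u) (v - w).
  by rewrite bilinear_subr// (bilinear_subl ab _ _ w) (RhP u).2// subrr subr0.
rewrite (le_trans (form_le ab norm_V2 _ _))// mulrAC ler_wpM2r//.
exact: ritz_dist_le.
Qed.

Lemma adjoint_ritz_norm_le v : `|Rh2 v| <= (1 + m) * `|v|.
Proof.
rewrite mulrDl mul1r -(subKr v (Rh2 v)) (le_trans (ler_normB _ _))//.
by rewrite lerD2l; have := adjoint_ritz_best v (findim_subspace0 fS2); rewrite subr0.
Qed.
End adjoint.
End ritz.

(** * Metric projection onto a convex set *)

Section metric_projection.
Variables (R : realType) (Q : hilbertType R) (K : set Q) (P : Q -> Q).
Hypothesis K_convex : convex_set (K : set (convex_lmodType Q)).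
Hypothesis PP : is_metric_proj K P.

Lemma metric_proj_variational q k : K k -> dot (q - P q) (k - P q) <= 0.
Proof.
move=> Kk; rewrite leNgt; apply/negP => d0.
have [KP Pmin] := PP q.
set d := dot _ _ in d0; set N := `|k - P q| ^+ 2.
have N0 : 0 <= N by rewrite sqr_ge0.
have dN : 0 < d + N by rewrite ltr_wpDr.
(* This fraction of the way from [P q] to [k] satisfies [0 < t <= 1] and [t * N <= d], so the
   squared distance to [q] changes by [t * (t * N - 2 * d) < 0]. *)
pose t := d / (d + N).
have t0 : 0 < t by rewrite divr_gt0.
have t1 : t <= 1 by rewrite ler_pdivrMr// mul1r lerDl.
have Kt : K (P q + t *: (k - P q)).
  have := K_convex (Itv01 (ltW t0) t1) (mem_set Kk) (mem_set KP).
  move/set_mem; rewrite /conv /=; rewrite /unstable.onem; congr K.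
  by rewrite scalerBl scale1r scalerBr addrCA.
have := Pmin _ Kt; rewrite -(@ler_pXn2r _ 2) ?nnegrE//.
rewrite opprD addrA (sqr_normD (q - P q)) normrN normrZ exprMn dotNr dotZr -/d -/N.
rewrite (ger0_norm (ltW t0)) => h.
have tN : t * N <= d.
  by rewrite /t mulrAC ler_pdivrMr// ler_pM2l// lerDr ltW.
have : 0 <= t * (t * N - 2 * d) by nra.
by rewrite pmulr_rge0//; lra.
Qed.

(** Sum of the variational inequalities at [q] and at [q'], each tested with the other
    projection. *)
Lemma metric_proj_firm q q' :
  `|P q - P q'| ^+ 2 <= dot (P q - P q') (q - q').
Proof.
have := metric_proj_variational q (PP q').1.
have := metric_proj_variational q' (PP q).1.
rewrite -dotvv !dotBl !dotBr !(dotC q) !(dotC q') (dotC (P q') (P q)).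
lra.
Qed.
End metric_projection.

(** * The Euclidean norm on a product *)

Section l2norm.
Variables (R : realType) (U V : normedModType R).
Implicit Types v w : U * V.

Lemma l2norm_ge0 v : 0 <= l2norm v.
Proof. exact: sqrtr_ge0. Qed.

Lemma sqr_l2norm v : l2norm v ^+ 2 = `|v.1| ^+ 2 + `|v.2| ^+ 2.
Proof. by rewrite sqr_sqrtr// addr_ge0 ?sqr_ge0. Qed.

Lemma l2norm_le v (c : R) :
  0 <= c -> (l2norm v <= c) = (`|v.1| ^+ 2 + `|v.2| ^+ 2 <= c ^+ 2).
Proof. by move=> c0; rewrite -sqr_l2norm ler_pXn2r// nnegrE l2norm_ge0. Qed.

Lemma l2norm_ge2 v : `|v.2| <= l2norm v.
Proof.
by rewrite -(@ler_pXn2r _ 2) ?nnegrE ?l2norm_ge0// sqr_l2norm lerDr sqr_ge0.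
Qed.

Lemma l2norm_ge1 v : `|v.1| <= l2norm v.
Proof.
by rewrite -(@ler_pXn2r _ 2) ?nnegrE ?l2norm_ge0// sqr_l2norm lerDl sqr_ge0.
Qed.

Lemma l2normD v w : l2norm (v + w) <= l2norm v + l2norm w.
Proof.
rewrite l2norm_le ?addr_ge0 ?l2norm_ge0// sqrrD !sqr_l2norm.
set x := l2norm v; set y := l2norm w.
have x0 : 0 <= x by exact: l2norm_ge0.
have y0 : 0 <= y by exact: l2norm_ge0.
have := sqr_l2norm v; have := sqr_l2norm w; rewrite -/x -/y => yE xE.
have h1 : `|v.1 + w.1| ^+ 2 <= (`|v.1| + `|w.1|) ^+ 2.
  by rewrite ler_pXn2r ?nnegrE ?addr_ge0// ler_normD.
have h2 : `|v.2 + w.2| ^+ 2 <= (`|v.2| + `|w.2|) ^+ 2.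
  by rewrite ler_pXn2r ?nnegrE ?addr_ge0// ler_normD.
(* Cauchy-Schwarz in the plane: the difference of the squares is a perfect square. *)
have xy : `|v.1| * `|w.1| + `|v.2| * `|w.2| <= x * y.
  rewrite -(@ler_pXn2r _ 2) ?nnegrE ?addr_ge0 ?mulr_ge0//.
  rewrite exprMn xE yE; have := sqr_ge0 (`|v.1| * `|w.2| - `|v.2| * `|w.1|); lra.
have -> : (v + w).1 = v.1 + w.1 by [].
have -> : (v + w).2 = v.2 + w.2 by [].
apply: (le_trans (lerD h1 h2)); rewrite -subr_ge0.
set lhs := (X in 0 <= X).
have -> : lhs = (x * y - (`|v.1| * `|w.1| + `|v.2| * `|w.2|)) *+ 2 by rewrite /lhs; ring.
by rewrite mulrn_wge0// subr_ge0.
Qed.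

Lemma l2dist_ge (S : set (U * V)) v (c : R) :
  S !=set0 -> (forall w, S w -> c <= l2norm (v - w)) -> c <= l2dist S v.
Proof.
move=> [s Ss] cS; rewrite /l2dist; apply: lb_le_inf.
  by exists (l2norm (v - s)); exists s.
by move=> _ [w Sw <-]; exact: cS.
Qed.

End l2norm.

(** * Error of the nonlinear variational discretization *)

Lemma sup_nonneg (R : realType) (E : set R) :
  (forall x, E x -> 0 <= x) -> 0 <= sup E.
Proof.
move=> E0; have [[[x Ex] ubE]|nE] := pselect (has_sup E); last by rewrite sup_out.
exact: le_trans (E0 x Ex) (ub_le_sup ubE Ex).
Qed.

Lemma inf_nonneg (R : realType) (E : set R) :
  (forall x, E x -> 0 <= x) -> 0 <= inf E.
Proof.
move=> E0; have [->|/set0P En] := eqVneq E set0; first by rewrite inf0.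
exact: lb_le_inf En E0.
Qed.

Lemma le_opnorm (R : realType) (U V : normedModType R) (T : {linear U -> V}) :
  continuous T -> forall u, `|T u| <= opnorm T * `|u|.
Proof.
move=> /linear_bounded_continuous/linear_boundedP/pinfty_ex_gt0[r r0 Tr] u.
have [->|u0] := eqVneq u 0; first by rewrite linear0 !normr0 mulr0.
have nu : 0 < `|u| by rewrite normr_gt0.
rewrite -ler_pdivrMr// mulrC -[X in X * _]gtr0_norm ?invr_gt0// -normrZ -linearZ.
apply: ub_le_sup.
  exists r => _ [w /= w1 <-]; rewrite (le_trans (Tr w))//.
  by rewrite -[leRHS]mulr1 ler_wpM2l// ltW.
exists (`|u|^-1 *: u) => //=.
by rewrite normrZ gtr0_norm ?invr_gt0// mulVf// gt_eqF.
Qed.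

Lemma opnorm_ge0 (R : realType) (U V : normedModType R) (T : {linear U -> V}) :
  0 <= opnorm T.
Proof. by apply: sup_nonneg => _ [u _ <-]. Qed.

Section discretization.
Variables (R : realType) (Q W V1 V2 : hilbertType R).
Variables (a : V1 -> V2 -> R) (Cs : V2 -> Q) (I : {linear V1 -> W}) (PK : Q -> Q).
Variable alpha : R.
Hypothesis ab : bounded_bilinear a.
Hypothesis norm_V2 :
  forall v2, `|v2| = sup [set a v1 v2 | v1 in [set v1 | `|v1| = 1]].
Hypothesis a_inj : forall v1, (forall v2, a v1 v2 = 0) -> v1 = 0.
Hypothesis Cs_sub : forall u v, Cs (u - v) = Cs u - Cs v.
Hypothesis alpha_gt0 : 0 < alpha.
Hypothesis PK_firm : forall q q',
  `|PK q - PK q'| ^+ 2 <= dot (PK q - PK q') (q - q').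
Variable M : R.
Hypothesis IM : forall v, `|I v| <= M * `|v|.
Hypothesis CsM : forall v, `|Cs v| <= M * `|v|.
Variables (S1 : set V1) (S2 : set V2) (Rh : V1 -> V1) (m : R).
Hypotheses (fS1 : findim_subspace S1) (fS2 : findim_subspace S2).
Hypothesis nd : nondegenerate_on a S1 S2.
Hypothesis RhP : is_ritz a S1 S2 Rh.
Hypothesis M_ge0 : 0 <= M.
Hypothesis m_ge0 : 0 <= m.
Hypothesis Rh_best : forall v w, S1 w -> `|v - Rh v| <= m * `|v - w|.
Variable Rh2 : V2 -> V2.
Hypothesis Rh2P :
  forall v2, S2 (Rh2 v2) /\ forall v1, a v1 (Rh2 v2) = a (Rh v1) v2.

Local Notation beta := (Num.sqrt alpha)^-1.

Let beta_gt0 : 0 < beta. Proof. by rewrite invr_gt0 sqrtr_gt0. Qed.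

Section error.
Variables (ud : W) (x xh : V1 * V2).
Hypothesis xP : solves a Cs I PK alpha setT ud x.
Hypothesis xhP : solves a Cs I PK alpha (S1 `*` S2) ud xh.

Let dI := I (x.1 - xh.1).
Let dP := PK (- beta *: Cs x.2) - PK (- beta *: Cs xh.2).
Let w1 := Rh x.1 - xh.1.
Let w2 := Rh2 x.2 - xh.2.

Let S1w1 : S1 w1.
Proof. by apply: findim_subspaceB => //; [exact: (RhP _).1|exact: xhP.1.1]. Qed.

Let S2w2 : S2 w2.
Proof. by apply: findim_subspaceB => //; [exact: (Rh2P _).1|exact: xhP.1.2]. Qed.

Let Cs0 : Cs 0 = 0. Proof. by have := Cs_sub 0 0; rewrite !subrr. Qed.

(** Test pairs [(0, phi)] isolate the state equation, and against [S2] the Ritz projection of [x.1]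
    acts like [x.1]. *)
Lemma state_error phi : S2 phi -> a w1 phi = dot dP (Cs phi).
Proof.
move=> Sphi; rewrite /w1 bilinear_subl// (RhP _).2//.
have S0phi : (S1 `*` S2) (0, phi) by split => //=; exact: findim_subspace0.
have := xhP.2 _ S0phi; rewrite -(xP.2 (0, phi) Logic.I) /bK/= !linear0 !dot0r !mulr0.
rewrite !bilinear0l// /dP dotBl; lra.
Qed.

(** Test pairs [(phi, 0)] isolate the adjoint equation; [Rh phi = phi] lets [x.2] stand for
    [Rh2 x.2]. *)
Lemma adjoint_error phi : S1 phi -> a phi w2 = beta * dot dI (I phi).
Proof.
move=> Sphi; rewrite /w2 bilinear_subr// (Rh2P _).2 (ritz_id ab fS1 nd RhP)//.
have S0phi : (S1 `*` S2) (phi, 0) by split => //=; exact: findim_subspace0.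
have := xhP.2 _ S0phi; rewrite -(xP.2 (phi, 0) Logic.I) /bK/= Cs0 !dot0r.
rewrite !bilinear0r// /dI linearB dotBl mulrBr; lra.
Qed.

(* Testing with the discrete errors, the firm nonexpansiveness of [PK] gives
   the term [dP] the same sign as the term [dI]. *)
Lemma weak_error :
  beta ^+ 2 * `|dI| ^+ 2 + `|dP| ^+ 2 <=
  beta ^+ 2 * (`|I (x.1 - Rh x.1)| ^+ 2 + `|Cs (x.2 - Rh2 x.2)| ^+ 2).
Proof.
(* Both error equations evaluate [a w1 w2]; equating them couples [dP] with [dI]. *)
have := adjoint_error S1w1; rewrite (state_error S2w2).
set D := I (x.1 - _); set G := Cs (x.2 - _).
have -> : I w1 = dI - D by rewrite -linearB; congr (I _); rewrite /w1 opprB [RHS]addrC addrA subrK.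
have -> : Cs w2 = Cs (x.2 - xh.2) - G.
  by rewrite -Cs_sub; congr (Cs _); rewrite /w2 opprB [RHS]addrC addrA subrK.
rewrite !dotBr dotvv => e.
have := PK_firm (- beta *: Cs x.2) (- beta *: Cs xh.2).
rewrite -/dP -scalerBr -Cs_sub dotZr => f.
(* Young's inequality for the two cross terms; half of the left-hand side absorbs their parts in
   [dI] and [dP]. *)
have h1 : 2 * dot dI D <= `|dI| ^+ 2 + `|D| ^+ 2.
  by have := sqr_normD dI (- D); rewrite dotNr normrN; have := sqr_ge0 `|dI - D|; lra.
have h2 : - (2 * beta * dot dP G) <= `|dP| ^+ 2 + beta ^+ 2 * `|G| ^+ 2.
  have := sqr_normD dP (beta *: G); rewrite dotZr normrZ exprMn (gtr0_norm beta_gt0).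
  by have := sqr_ge0 `|dP + beta *: G|; lra.
have b2 : 0 <= beta ^+ 2 by exact: sqr_ge0.
have h3 := ler_wpM2l b2 h1.
have e' := congr1 (fun t => beta * t) e; rewrite /= in e'.
nra.
Qed.

(** As [Rh] fixes [w1], any test function [v] can be replaced by the discrete [Rh2 v], at the cost
    of the stability factor [1 + m]. *)
Lemma state_error_norm : `|w1| <= (1 + m) * M * `|dP|.
Proof.
apply: (form_norm_le1 ab norm_V2 a_inj) => [|v].
  by rewrite !mulr_ge0// addr_ge0.
rewrite -{1}(ritz_id ab fS1 nd RhP S1w1) -(Rh2P v).2 state_error; last exact: (Rh2P v).1.
rewrite (le_trans (dot_le _ _))// [leRHS]mulrAC [leLHS]mulrC ler_wpM2r//.
rewrite (le_trans (CsM _))// [(1 + m) * M]mulrC -mulrA ler_wpM2l//.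
exact: (adjoint_ritz_norm_le ab norm_V2 fS1 fS2 RhP m_ge0 Rh_best Rh2P).
Qed.

Lemma adjoint_error_norm : `|w2| <= (1 + m) * M * (beta * `|dI|).
Proof.
apply: (form_norm_le2 norm_V2) => [|u].
  by rewrite !mulr_ge0 ?addr_ge0// ltW.
rewrite -(RhP u).2// adjoint_error; last exact: (RhP u).1.
rewrite [_ * (beta * _)]mulrCA -[leRHS]mulrA ler_wpM2l ?(ltW beta_gt0)//.
rewrite (le_trans (dot_le _ _))// [leRHS]mulrAC [leLHS]mulrC ler_wpM2r//.
rewrite (le_trans (IM _))// [(1 + m) * M]mulrC -mulrA ler_wpM2l//.
exact: (ritz_norm_le fS1 Rh_best).
Qed.

Variable eta : R.
Hypothesis eta_ge0 : 0 <= eta.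
Hypothesis I_eta : forall v, `|I (v - Rh v)| <= eta * `|v - Rh v|.
Hypothesis Cs_eta : forall v, `|Cs (v - Rh2 v)| <= eta * `|v - Rh2 v|.

(** The error is split at the pair [r] of Ritz projections: [x - r] is quasi-optimal with factor
    [m], and [r - xh] is smaller than [x - r] by a factor proportional to [eta]. *)
Lemma discretization_error w : (S1 `*` S2) w ->
  l2norm (x - xh) <= m * (1 + (1 + m) * (M * beta) * eta) * l2norm (x - w).
Proof.
move=> [Sw1 Sw2].
set r : V1 * V2 := (Rh x.1, Rh2 x.2).
have c0 : 0 <= (1 + m) * (M * beta) * eta.
  by rewrite !mulr_ge0 ?addr_ge0// ltW.
have best : l2norm (x - r) <= m * l2norm (x - w).
  rewrite l2norm_le ?mulr_ge0 ?l2norm_ge0// exprMn sqr_l2norm mulrDr -!exprMn.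
  apply: lerD; rewrite ler_pXn2r ?nnegrE ?mulr_ge0//; first exact: Rh_best.
  exact: (adjoint_ritz_best ab norm_V2 fS1 RhP m_ge0 Rh_best Rh2P).
have super : l2norm (r - xh) <= (1 + m) * (M * beta) * eta * l2norm (x - r).
  rewrite l2norm_le ?(mulr_ge0 c0) ?l2norm_ge0// exprMn sqr_l2norm.
  have -> : (r - xh).1 = w1 by [].
  have -> : (r - xh).2 = w2 by [].
  have cM0 : 0 <= (1 + m) * M by rewrite mulr_ge0// addr_ge0.
  have h1 : `|w1| ^+ 2 <= ((1 + m) * M * `|dP|) ^+ 2.
    by rewrite ler_pXn2r ?nnegrE ?(mulr_ge0 cM0)//; exact: state_error_norm.
  have h2 : `|w2| ^+ 2 <= ((1 + m) * M * (beta * `|dI|)) ^+ 2.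
    rewrite ler_pXn2r ?nnegrE ?(mulr_ge0 cM0) ?mulr_ge0 ?(ltW beta_gt0)//.
    exact: adjoint_error_norm.
  have h3 : `|I (x.1 - Rh x.1)| ^+ 2 <= eta ^+ 2 * `|x.1 - Rh x.1| ^+ 2.
    by rewrite -exprMn ler_pXn2r ?nnegrE ?mulr_ge0.
  have h4 : `|Cs (x.2 - Rh2 x.2)| ^+ 2 <= eta ^+ 2 * `|x.2 - Rh2 x.2| ^+ 2.
    by rewrite -exprMn ler_pXn2r ?nnegrE ?mulr_ge0.
  have h5 := lerD h3 h4.
  have c2 : 0 <= ((1 + m) * M) ^+ 2 by exact: sqr_ge0.
  have b2 : 0 <= beta ^+ 2 by exact: sqr_ge0.
  have h6 := ler_wpM2l c2 (le_trans weak_error (ler_wpM2l b2 h5)).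
  apply: (le_trans (lerD h1 h2)); move: h6; rewrite -/dI -/dP.
  set n1 := `|x.1 - _|; set n2 := `|x.2 - _| => h6.
  set lhs := (X in X <= _); set rhs := (X in _ <= X).
  have -> : lhs = ((1 + m) * M) ^+ 2 * (beta ^+ 2 * `|dI| ^+ 2 + `|dP| ^+ 2).
    by rewrite /lhs; ring.
  apply: (le_trans h6); rewrite le_eqVlt; apply/orP; left; apply/eqP.
  by rewrite /rhs; ring.
have -> : x - xh = (x - r) + (r - xh) by rewrite addrA subrK.
rewrite (le_trans (l2normD _ _))//.
rewrite (le_trans (lerD (lexx _) super))// -{1}[l2norm (x - r)]mul1r -mulrDl.
by rewrite [m * (1 + _)]mulrC -[leRHS]mulrA ler_wpM2l// addr_ge0.
Qed.
End error.

Lemma discr_const_le eta : 1 <= m -> 0 <= eta ->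
  (forall v, `|I (v - Rh v)| <= eta * `|v - Rh v|) ->
  (forall v, `|Cs (v - Rh2 v)| <= eta * `|v - Rh2 v|) ->
  (discr_const a Cs I PK alpha (S1 `*` S2) <=
   (m * (1 + (1 + m) * (M * beta) * eta))%:E)%E.
Proof.
move=> m1 eta0 I_eta Cs_eta; set c := m * _.
have c1 : 1 <= c.
  by rewrite /c mulr_ege1// lerDl !mulr_ge0 ?addr_ge0// ltW.
have c0 : 0 < c by exact: lt_le_trans c1.
apply: ereal_inf_lbound; exists c => //; split => // ud x xh xP xhP.
rewrite mulrC -ler_pdivrMr//; apply: l2dist_ge => [|w Sw].
  by exists (0, 0); split; exact: findim_subspace0.
rewrite ler_pdivrMr// mulrC.
exact: (discretization_error xP xhP eta0 I_eta Cs_eta Sw).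
Qed.
End discretization.

(** * Duality and compactness *)

Section dual.
Variables (R : realType) (V : normedModType R).
Implicit Types f g : dual V.

Lemma dual_linear f (c : R) u v : f (c *: u + v) = c * f u + f v.
Proof. by have /asboolP[+ _] := dualP f; apply. Qed.

Lemma dual_sub f u v : f (u - v) = f u - f v.
Proof. by rewrite addrC -scaleN1r dual_linear mulN1r addrC. Qed.

Lemma dual_bound f v : `|f v| <= `|f| * `|v|.
Proof.
have f0 : f 0 = 0 by have := dual_sub f 0 0; rewrite !subrr.
have fZ c u : f (c *: u) = c * f u by have := dual_linear f c u 0; rewrite f0 !addr0.
have [->|v0] := eqVneq v 0; first by rewrite f0 !normr0 mulr0.
have nv : 0 < `|v| by rewrite normr_gt0.
rewrite -ler_pdivrMr// mulrC -[X in X * _]gtr0_norm ?invr_gt0// -normrM -fZ.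
by apply: dual_norm_ub; rewrite normrZ gtr0_norm ?invr_gt0// mulVf ?gt_eqF.
Qed.
End dual.

Section adjoint_operator.
Variables (R : realType) (Q : hilbertType R) (V : hilbertType R).
Variables (C : {linear Q -> dual V}) (Cs : V -> Q).
Hypothesis CsP : forall q v, dot q (Cs v) = C q v.

Lemma adjoint_sub u v : Cs (u - v) = Cs u - Cs v.
Proof. by apply: dot_inj => q; rewrite dotBr !CsP dual_sub. Qed.

Lemma adjoint_bound : continuous C -> forall v, `|Cs v| <= opnorm C * `|v|.
Proof.
move=> Cc v; have [->|q0] := eqVneq (Cs v) 0.
  by rewrite normr0 mulr_ge0// opnorm_ge0.
rewrite -(@ler_pM2l _ `|Cs v|) ?normr_gt0// -expr2 -dotvv CsP.
rewrite (le_trans (ler_norm _))// (le_trans (dual_bound _ _))//.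
by rewrite [leRHS]mulrCA mulrA ler_wpM2r// le_opnorm.
Qed.
End adjoint_operator.

(** The bound by [mubar] makes the infimum finite, and the admissible constants form a closed
    condition. *)
Lemma ritz_const_attained (R : realType) (V : hilbertType R) (S : set V)
    (Rh : V -> V) (mubar : R) : (ritz_const S Rh <= mubar%:E)%E ->
  exists m, [/\ ritz_const S Rh = m%:E, 1 <= m, m <= mubar &
    forall v w, S w -> `|v - Rh v| <= m * `|v - w|].
Proof.
rewrite /ritz_const /best_const; set A := (X in ereal_inf X) => Amu.
have A1 : (1%:E <= ereal_inf A)%E by apply: le_ereal_inf_tmp => _ [c [c1 _] <-]; rewrite lee_fin.
have Afin : ereal_inf A \is a fin_num.
  by rewrite fin_numE gt_eqF ?(lt_le_trans _ A1) ?ltNyr// lt_eqF// (le_lt_trans Amu) ?ltry.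
exists (fine (ereal_inf A)); split; rewrite ?fineK//.
- by rewrite -lee_fin fineK.
- by rewrite -lee_fin fineK.
move=> v w Sw.
have Ale c : A c%:E -> `|v - Rh v| <= c * `|v - w|.
  move=> [k [c1 cP] [<-]]; rewrite (le_trans (cP v))// ler_wpM2l ?(le_trans ler01)//.
  by apply: ge_inf; [exists 0 => _ [? _ <-] | exists w].
(* Division by [|v - w|] fails here, so some admissible constant is used; one exists because the
   infimum is below [mubar + 1]. *)
have [vw|vw] := eqVneq `|v - w| 0.
  have [|_ [c cP <-] _] := @ereal_inf_lt _ A (mubar + 1)%:E.
    by rewrite (le_lt_trans Amu)// lte_fin ltrDl.
  by have := Ale c; rewrite vw !mulr0; apply; exists c.
have vw0 : 0 < `|v - w| by rewrite lt0r vw normr_ge0.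
rewrite -ler_pdivrMr// -lee_fin fineK//; apply: le_ereal_inf_tmp => _ [c cP <-].
by rewrite lee_fin ler_pdivrMr//; apply: Ale; exists c.
Qed.

Section relative_norm.
Variables (R : realType) (V W : normedModType R) (f : V -> W).

(** The operator norm of [f] restricted to [E]; a zero vector contributes [0], since division by [0]
    gives [0]. *)
Definition relnorm (E : set V) : R := sup [set `|f t| / `|t| | t in E].

Lemma relnorm_ge0 E : 0 <= relnorm E.
Proof. by apply: sup_nonneg => _ [t _ <-]; rewrite divr_ge0. Qed.

Lemma relnorm_le E (c : R) : 0 <= c ->
  (forall t, E t -> `|f t| <= c * `|t|) -> relnorm E <= c.
Proof.
move=> c0 fc; rewrite /relnorm; set A := (X in sup X).
have [->|/set0P A0] := eqVneq A set0; first by rewrite sup0.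
apply: ge_sup => // _ [t Et <-].
have [t0|t0] := eqVneq `|t| 0; first by rewrite t0 invr0 mulr0.
by rewrite ler_pdivrMr ?lt0r ?t0//= fc.
Qed.

Lemma le_relnorm E (c : R) t : (forall t, `|f t| <= c * `|t|) ->
  E t -> `|f t| <= relnorm E * `|t|.
Proof.
move=> fc Et; have [t0|t0] := eqVneq `|t| 0.
  by have := fc t; rewrite t0 !mulr0.
have t1 : 0 < `|t| by rewrite lt0r t0 normr_ge0.
rewrite -ler_pdivrMr//; apply: ub_le_sup; last by exists t.
exists `|c| => _ [s _ <-]; have [s0|s0] := eqVneq `|s| 0.
  by rewrite s0 invr0 mulr0.
have s1 : 0 < `|s| by rewrite lt0r s0 normr_ge0.
by rewrite ler_pdivrMr// (le_trans (fc s))// ler_wpM2r// ler_norm.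
Qed.
End relative_norm.

(** Pointwise smallness becomes uniform on a compact set because [b] is Lipschitz in its first
    argument, uniformly for [t] of bounded norm. *)
Lemma compact_uniform_small (R : realType) (X V : normedModType R)
    (b : X -> V -> R) (c : R) (E : nat -> set V) (K : set X) :
  compact K ->
  (forall x x' t, `|b x t - b x' t| <= c * `|x - x'| * `|t|) ->
  (forall x e, 0 < e -> \forall n \near \oo,
     forall t, E n t -> `|b x t| <= e * `|t|) ->
  forall e, 0 < e -> \forall n \near \oo,
    forall x t, K x -> E n t -> `|b x t| <= e * `|t|.
Proof.
move=> /compact_near_coveringP cK bc bE e e0.
have e2 : 0 < e / 2 by rewrite divr_gt0.
have c1 : 0 < `|c| + 1 by rewrite ltr_wpDl.
suff: \forall n \near \oo, K `<=` (fun x => forall t, E n t -> `|b x t| <= e * `|t|).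
  by apply: filterS => n Kn x t Kx; exact: Kn.
apply: cK => x _.
(* On a ball of this radius the Lipschitz error is at most [e / 2]; the [+ 1] keeps the radius well
   defined for [c = 0]. *)
exists (ball x (e / 2 / (`|c| + 1)), [set n | forall t, E n t -> `|b x t| <= e / 2 * `|t|]).
  by split => /=; [apply: nbhsx_ballx; rewrite divr_gt0|exact: bE].
move=> [x' n] [/= xx' nE] t Et.
rewrite -(subrK (b x t) (b x' t)) (le_trans (ler_normD _ _))//.
rewrite [e]splitr mulrDl lerD ?nE// (le_trans (bc _ _ _))// ler_wpM2r//.
move: xx'; rewrite -ball_normE /= distrC ltr_pdivlMr// => /ltW; apply: le_trans.
by rewrite mulrC ler_wpM2l// (le_trans (ler_norm _))// lerDl.
Qed.

Section galerkin_orthogonality.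
Variables (R : realType) (V1 V2 : hilbertType R) (a : V1 -> V2 -> R).
Hypothesis ab : bounded_bilinear a.
Hypothesis norm_V2 :
  forall v2, `|v2| = sup [set a v1 v2 | v1 in [set v1 | `|v1| = 1]].
Variables (S1 : set V1) (S2 : set V2) (Rh : V1 -> V1) (Rh2 : V2 -> V2).
Hypotheses (fS1 : findim_subspace S1) (fS2 : findim_subspace S2).
Hypothesis nd : nondegenerate_on a S1 S2.
Hypothesis RhP : is_ritz a S1 S2 Rh.
Hypothesis Rh2P :
  forall v2, S2 (Rh2 v2) /\ forall v1, a v1 (Rh2 v2) = a (Rh v1) v2.

(** Galerkin orthogonality: [v - Rh v] annihilates [S2], so [y] may be replaced by [y - w2] for
    every discrete [w2]. *)
Lemma ritz_duality v y :
  `|a (v - Rh v) y| <= l2dist (S1 `*` S2) (0, y) * `|v - Rh v|.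
Proof.
set t := v - Rh v.
have [t0|t0] := eqVneq t 0; first by rewrite t0 bilinear0l// !normr0 mulr0.
have nt : 0 < `|t| by rewrite normr_gt0.
rewrite -ler_pdivrMr//; apply: l2dist_ge.
  by exists (0, 0); split; exact: findim_subspace0.
move=> [w1 w2] [/= _ Sw2]; rewrite ler_pdivrMr//.
have -> : a t y = a t (y - w2).
  by rewrite bilinear_subr// (bilinear_subl ab v _ w2) (RhP v).2// subrr subr0.
rewrite (le_trans (normr_form_le ab norm_V2 _ _))// mulrC ler_wpM2r//.
exact: (l2norm_ge2 ((0, y) - (w1, w2))).
Qed.

Lemma adjoint_ritz_duality v y :
  `|a y (v - Rh2 v)| <= l2dist (S1 `*` S2) (y, 0) * `|v - Rh2 v|.
Proof.
set t := v - Rh2 v.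
have [t0|t0] := eqVneq t 0; first by rewrite t0 bilinear0r// !normr0 mulr0.
have nt : 0 < `|t| by rewrite normr_gt0.
rewrite -ler_pdivrMr//; apply: l2dist_ge.
  by exists (0, 0); split; exact: findim_subspace0.
move=> [w1 w2] [/= Sw1 _]; rewrite ler_pdivrMr//.
have -> : a y t = a (y - w1) t.
  rewrite bilinear_subl// (bilinear_subr ab w1) (Rh2P v).2.
  by rewrite (ritz_id ab fS1 nd RhP)// subrr subr0.
rewrite (le_trans (normr_form_le ab norm_V2 _ _))// ler_wpM2r//.
exact: (l2norm_ge1 ((y, 0) - (w1, w2))).
Qed.
End galerkin_orthogonality.

Lemma relnorm_cvg0 (R : realType) (V W : normedModType R) (f : V -> W)
    (E : nat -> set V) :
  (forall e : R, 0 < e -> \forall n \near \oo, forall t, E n t -> `|f t| <= e * `|t|) ->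
  relnorm f (E n) @[n --> \oo] --> (0 : R).
Proof.
move=> fE; apply/cvgr0Pnorm_le => e e0; near=> n.
rewrite ger0_norm ?relnorm_ge0// relnorm_le ?(ltW e0)//.
by near: n; exact: fE.
Unshelve. all: by end_near.
Qed.

Section seminormed_dual_norm.
Variables (R : realType) (X : lmodType R) (D : set X) (N F : X -> R).

Lemma in_dual_norm_le (c : R) : 0 <= c ->
  (forall u, D u -> N u <= 1 -> `|F u| <= c) -> in_dual_norm D N F <= c.
Proof.
move=> c0 Fc; rewrite /in_dual_norm; set A := (X in sup X).
have [->|/set0P A0] := eqVneq A set0; first by rewrite sup0.
by apply: ge_sup => // _ [t [Dt Nt] <-]; exact: Fc.
Qed.
End seminormed_dual_norm.

Lemma in_dual0 (R : realType) (X : lmodType R) (D : set X) (N : X -> R) :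
  in_dual D N (fun=> 0).
Proof.
split=> [c u v _ _|]; first by rewrite scaler0 addr0.
by exists 0 => u _; rewrite normr0 mul0r.
Qed.

Lemma Hnorm_ge0 (R : realType) (d : nat) (Om : set 'rV[R]_d) (s : R) u :
  0 <= Hnorm Om s u.
Proof.
rewrite /Hnorm; case: ifP => _; first by apply: sup_nonneg => _ [phi _ <-].
by apply: inf_nonneg => _ [f _ <-]; exact: sqrtr_ge0.
Qed.

(** * Smallness of [I] and [Cs] on the ranges of the Ritz errors *)

Section error_operators.
Variables (R : realType) (Q W V1 V2 : hilbertType R) (a : V1 -> V2 -> R).
Hypothesis ab : bounded_bilinear a.
Hypothesis norm_V2 :
  forall v2, `|v2| = sup [set a v1 v2 | v1 in [set v1 | `|v1| = 1]].
Hypothesis a_inj : forall v1, (forall v2, a v1 v2 = 0) -> v1 = 0.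
Variables (C : {linear Q -> dual V2}) (Cs : V2 -> Q) (I : {linear V1 -> W}).
Hypothesis I_bounded : continuous I.
Hypothesis CsP : forall q v2, dot q (Cs v2) = C q v2.
Variables (S1 : nat -> set V1) (S2 : nat -> set V2).
Variables (Rh : nat -> V1 -> V1) (Rh2 : nat -> V2 -> V2).
Hypothesis fS1 : forall n, findim_subspace (S1 n).
Hypothesis fS2 : forall n, findim_subspace (S2 n).
Hypothesis nd : forall n, nondegenerate_on a (S1 n) (S2 n).
Hypothesis RhP : forall n, is_ritz a (S1 n) (S2 n) (Rh n).
Hypothesis Rh2P : forall n v2,
  S2 n (Rh2 n v2) /\ forall v1, a v1 (Rh2 n v2) = a (Rh n v1) v2.

Let duality1 n v y :
  `|a (v - Rh n v) y| <= l2dist (S1 n `*` S2 n) (0, y) * `|v - Rh n v|.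
Proof. exact: ritz_duality. Qed.

Let duality2 n v y :
  `|a y (v - Rh2 n v)| <= l2dist (S1 n `*` S2 n) (y, 0) * `|v - Rh2 n v|.
Proof. exact: (adjoint_ritz_duality ab norm_V2 (fS1 n) (fS2 n) (nd n)). Qed.

(** [y] solves the linear adjoint problem of the duality argument, with data [I^* w]. *)
Let riesz_I w : exists y, forall u, a u y = dot w (I u).
Proof.
apply: (form_represents1 ab norm_V2 a_inj (c := `|w| * opnorm I)) => [k u v|u].
  by rewrite linearP dotDr dotZr.
rewrite (le_trans (normr_dot_le _ _))// -mulrA ler_wpM2l//.
exact: le_opnorm.
Qed.

Let riesz_dual (g : dual V2) : exists y, forall v, a y v = g v.
Proof.
apply: (form_represents2 ab norm_V2 a_inj (c := `|g|)) => [k u v|v].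
  exact: dual_linear.
exact: dual_bound.
Qed.

Section compact.
Hypothesis approx : forall v, l2dist (S1 n `*` S2 n) v @[n --> \oo] --> (0 : R).

Let approx_le v (e : R) : 0 < e -> \forall n \near \oo, l2dist (S1 n `*` S2 n) v <= e.
Proof.
move=> e0; have /cvgr0Pnorm_le/(_ e e0) := approx v.
by apply: filterS => n; apply: le_trans; exact: ler_norm.
Qed.

(** Uniform smallness is used at [w = I (t / |t|)], where [dot w (I t) = |I t|^2 / |t|]; hence the
    tolerance [e^2]. *)
Lemma compact_ritz_error : compact_operator I ->
  relnorm I (range (fun v => v - Rh n v)) @[n --> \oo] --> (0 : R).
Proof.
move=> cI; apply: relnorm_cvg0 => e e0; have e2 : 0 < e ^+ 2 by rewrite exprn_gt0.
have := @compact_uniform_small _ _ _ (fun w t => dot w (I t)) (opnorm I)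
  (fun n => range (fun v => v - Rh n v)) _ cI _ _ _ e2.
case=> [w w' t|w k k0|N _ NP].
- rewrite -dotBl (le_trans (normr_dot_le _ _))// -[leRHS]mulrA mulrCA ler_wpM2l//.
  exact: le_opnorm.
- have [y yP] := riesz_I w; have := approx_le (0, y) k0.
  apply: filterS => n nk _ [v _ <-]; rewrite -yP.
  by rewrite (le_trans (duality1 _ _ _))// ler_wpM2r.
exists N => // n /NP {}NP t Et.
have [->|t0] := eqVneq t 0; first by rewrite linear0 !normr0 mulr0.
have nt : 0 < `|t| by rewrite normr_gt0.
rewrite -(@ler_pXn2r _ 2) ?nnegrE ?mulr_ge0 ?(ltW e0)//.
have cl : closure (I @` [set u | `|u| <= 1]) (I (`|t|^-1 *: t)).
  apply: subset_closure; exists (`|t|^-1 *: t) => //=.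
  by rewrite normrZ gtr0_norm ?invr_gt0// mulVf ?gt_eqF.
have := NP _ _ cl Et; rewrite linearZ dotZl dotvv normrM gtr0_norm ?invr_gt0//.
by rewrite mulrC ler_pdivrMr// ger0_norm ?sqr_ge0// exprMn -mulrA -expr2.
Qed.

(** Here the functional is [g = C (q / |q|)] with [q = Cs t], for which [g t = |Cs t|]; the
    tolerance is [e] itself. *)
Lemma compact_adjoint_ritz_error : compact_operator C ->
  relnorm Cs (range (fun v => v - Rh2 n v)) @[n --> \oo] --> (0 : R).
Proof.
move=> cC; apply: relnorm_cvg0 => e e0.
have := @compact_uniform_small _ _ _ (fun (g : dual V2) t => g t) 1
  (fun n => range (fun v => v - Rh2 n v)) _ cC _ _ _ e0.
case=> [g g' t|g k k0|N _ NP].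
- by rewrite mul1r; exact: (dual_bound (g - g') t).
- have [y yP] := riesz_dual g; have := approx_le (y, 0) k0.
  apply: filterS => n nk _ [v _ <-]; rewrite -yP.
  by rewrite (le_trans (duality2 _ _ _))// ler_wpM2r.
exists N => // n /NP {}NP t Et.
have [->|q0] := eqVneq (Cs t) 0; first by rewrite normr0 mulr_ge0// ltW.
have nq : 0 < `|Cs t| by rewrite normr_gt0.
have cl : closure (C @` [set u | `|u| <= 1]) (C (`|Cs t|^-1 *: Cs t)).
  apply: subset_closure; exists (`|Cs t|^-1 *: Cs t) => //=.
  by rewrite normrZ gtr0_norm ?invr_gt0// mulVf ?gt_eqF.
have := NP _ _ cl Et; rewrite -CsP dotZl dotvv expr2 mulKf ?gt_eqF//.
by rewrite normr_id.
Qed.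
End compact.

Section sobolev.
Variables (d : nat) (Om : set 'rV[R]_d) (s1 s2 delta : R).
Variables (J1 : V1 -> gfun R d) (J2 : V2 -> gfun R d) (h : nat -> R).
Hypothesis Q2 : condQ2 Om J1 J2 s1 s2 delta C I.
Hypothesis Q3 : condQ3 Om J1 J2 s1 s2 delta a.
Hypothesis Q4 : condQ4 Om J1 J2 s1 s2 delta h (fun n => S1 n `*` S2 n).

(** With [w = I t] and [y] the adjoint solution for data [I^* w], duality bounds [|w|^2] by the
    distance of [(0, y)] to the discrete space times [|t|]; regularity and approximation bound that
    distance by a multiple of [h^delta * |w|]. *)
Lemma sobolev_ritz_error : exists c, 0 <= c /\ forall n v,
  `|I (v - Rh n v)| <= c * h n `^ delta * `|v - Rh n v|.
Proof.
have [_ [It [It_lin [c It_le] IE]]] := Q2.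
have [CR [CR0 Q3a Q3b]] := Q3; have [CI [CI0 Q4']] := Q4.
(* The approximation condition asks for regular representatives of both components; the zero
   functional supplies one of norm [0] for the zero state. *)
have [|w1 w1_reg w1n] := Q3a _ (in_dual0 _ _) 0.
  by move=> v2; rewrite bilinear0l.
have {}w1n : Hnorm Om (s1 + delta) w1 = 0.
  apply/eqP; rewrite eq_le Hnorm_ge0 andbT (le_trans w1n)// pmulr_rle0//.
  by apply: in_dual_norm_le => // u _ _; rewrite normr0.
exists (CI * (CR * `|c|)); split; first by rewrite !mulr_ge0// ltW.
move=> n v; set t := v - _; set w := I t.
have [w0|w0] := eqVneq w 0; first by rewrite w0 normr0 !mulr_ge0 ?powR_ge0// ltW.
have nw : 0 < `|w| by rewrite normr_gt0.
(* The extension of [I^* w] to a functional on the larger space of order [s1 - delta], as the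
   regularity condition requires. *)
pose G u := dot w (It u).
have G_le u : H Om (s1 - delta) u -> `|G u| <= `|w| * `|c| * Hnorm Om (s1 - delta) u.
  move=> Hu; rewrite (le_trans (normr_dot_le _ _))// -mulrA ler_wpM2l//.
  by rewrite (le_trans (It_le u Hu))// ler_wpM2r ?Hnorm_ge0// ler_norm.
have GH : Hdual Om (s1 - delta) G.
  split=> [k u u' Hu Hu'|]; last by exists (`|w| * `|c|).
  by rewrite /G It_lin// dotDr dotZr.
have Gn : Hdual_norm Om (s1 - delta) G <= `|c| * `|w|.
  apply: in_dual_norm_le => [|u Hu u1]; first by rewrite mulr_ge0.
  by rewrite mulrC (le_trans (G_le u Hu))// ler_piMr// mulr_ge0.
have [y yP] := riesz_I w.
have [|w2 w2_reg w2n] := Q3b G GH y; first by move=> v1; rewrite yP IE.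
have := Q4' n (0, y) w1 w2 w1_reg w2_reg.
rewrite w1n expr0n add0r sqrtr_sqr ger0_norm ?Hnorm_ge0// => le_l2.
have := duality1 n v y; rewrite yP -/t -/w dotvv ger0_norm ?sqr_ge0// => w_le.
rewrite -(@ler_pM2l _ `|w|)// -expr2 (le_trans w_le)//.
rewrite [leRHS]mulrA ler_wpM2r// (le_trans le_l2)//.
have -> : `|w| * (CI * (CR * `|c|) * h n `^ delta) =
  CI * h n `^ delta * (CR * (`|c| * `|w|)) by ring.
rewrite ler_wpM2l ?mulr_ge0 ?powR_ge0 ?(ltW CI0)//.
by rewrite (le_trans w2n)// ler_wpM2l// ltW.
Qed.

(** The mirror argument: [q = Cs t], and [y] solves the state problem with data [C q], which [Ct q]
    extends. *)
Lemma sobolev_adjoint_ritz_error : exists c, 0 <= c /\ forall n v,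
  `|Cs (v - Rh2 n v)| <= c * h n `^ delta * `|v - Rh2 n v|.
Proof.
have [[Ct [CtH _ [c Ct_le] CE]] _] := Q2.
have [CR [CR0 Q3a Q3b]] := Q3; have [CI [CI0 Q4']] := Q4.
have [|w2 w2_reg w2n] := Q3b _ (in_dual0 _ _) 0.
  by move=> v1; rewrite bilinear0r.
have {}w2n : Hnorm Om (s2 + delta) w2 = 0.
  apply/eqP; rewrite eq_le Hnorm_ge0 andbT (le_trans w2n)// pmulr_rle0//.
  by apply: in_dual_norm_le => // u _ _; rewrite normr0.
exists (CI * (CR * `|c|)); split; first by rewrite !mulr_ge0// ltW.
move=> n v; set t := v - _; set q := Cs t.
have [q0|q0] := eqVneq q 0; first by rewrite q0 normr0 !mulr_ge0 ?powR_ge0// ltW.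
have nq : 0 < `|q| by rewrite normr_gt0.
have [y yP] := riesz_dual (C q).
have [|w1 w1_reg w1n] := Q3a (Ct q) (CtH q) y; first by move=> v2; rewrite yP CE.
have := Q4' n (y, 0) w1 w2 w1_reg w2_reg.
rewrite w2n expr0n addr0 sqrtr_sqr ger0_norm ?Hnorm_ge0// => le_l2.
have := duality2 n v y; rewrite yP -/t -CsP -/q dotvv ger0_norm ?sqr_ge0// => q_le.
rewrite -(@ler_pM2l _ `|q|)// -expr2 (le_trans q_le)//.
rewrite [leRHS]mulrA ler_wpM2r// (le_trans le_l2)//.
have -> : `|q| * (CI * (CR * `|c|) * h n `^ delta) =
  CI * h n `^ delta * (CR * (`|c| * `|q|)) by ring.
rewrite ler_wpM2l ?mulr_ge0 ?powR_ge0 ?(ltW CI0)//.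
rewrite (le_trans w1n)// ler_wpM2l ?(ltW CR0)// (le_trans (Ct_le q))//.
by rewrite ler_wpM2r// ler_norm.
Qed.
End sobolev.
End error_operators.

Theorem corollary5p6 (R : realType) (Q W V1 V2 : hilbertType R)
  (a : V1 -> V2 -> R)
  (a_bounded : bounded_bilinear a)
  (a_inj : forall v1, (forall v2, a v1 v2 = 0) -> v1 = 0)
  (a_infsup : (0 < ereal_inf
     [set ereal_sup [set (a v1 v2)%:E | v1 in [set v1 : V1 | (`|v1| = 1)%R]]
       | v2 in [set v2 : V2 | (`|v2| = 1)%R]])%E)
  (norm_V2 : forall v2, `|v2| = sup [set a v1 v2 | v1 in [set v1 | `|v1| = 1]])
  (C : {linear Q -> dual V2}) (C_bounded : continuous C)
  (I : {linear V1 -> W}) (I_bounded : continuous I)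
  (Cs : V2 -> Q) (CsP : forall q v2, dot q (Cs v2) = C q v2)
  (alpha : R) (alpha_gt0 : 0 < alpha)
  (K : set Q) (K_nonempty : K !=set0) (K_closed : closed K)
  (K_convex : convex_set (K : set (convex_lmodType Q)))
  (PK : Q -> Q) (PKP : is_metric_proj K PK)
  (h : nat -> R) (h_gt0 : forall n, 0 < h n) (h_cvg0 : h @ \oo --> (0 : R))
  (Vh1 : nat -> set V1) (Vh2 : nat -> set V2)
  (Vh1_findim : forall n, findim_subspace (Vh1 n))
  (Vh2_findim : forall n, findim_subspace (Vh2 n))
  (Vh_nondeg : forall n, nondegenerate_on a (Vh1 n) (Vh2 n))
  (Rh1 : nat -> V1 -> V1)
  (Rh1P : forall n, is_ritz a (Vh1 n) (Vh2 n) (Rh1 n))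
  (mubar : R) (mubar_ge1 : 1 <= mubar)
  (mu_le : forall n, (ritz_const (Vh1 n) (Rh1 n) <= mubar%:E)%E) :
  let Vh n := Vh1 n `*` Vh2 n in
  let mu n := ritz_const (Vh1 n) (Rh1 n) in
  let nu n := discr_const a Cs I PK alpha (Vh n) in
  let M := Num.max (opnorm I) (opnorm C) in
  let L := M / Num.sqrt alpha in
  let kbar := (1 + 2 * L) / (1 + L) *
              (1 + M * (1 + 2 * M / Num.sqrt alpha) * mubar) in
  (compact_operator I -> compact_operator C ->
   (forall v, l2dist (Vh n) v @[n --> \oo] --> (0 : R)) ->
   exists eps : nat -> R, eps @ \oo --> (0 : R) /\
     forall n, (nu n <= mu n * (1 + M / Num.sqrt alpha * kbar * eps n)%:E)%E) /\
  (forall (d : nat) (Om : set 'rV[R]_d), domain Om -> sobolev_scale Om ->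
   forall (s1 s2 delta : R) (J1 : V1 -> gfun R d) (J2 : V2 -> gfun R d),
   0 < delta ->
   condQ1 Om J1 J2 s1 s2 -> condQ2 Om J1 J2 s1 s2 delta C I ->
   condQ3 Om J1 J2 s1 s2 delta a -> condQ4 Om J1 J2 s1 s2 delta h Vh ->
   exists eps : nat -> R, eps =O_\oo (fun n => h n `^ delta : R) /\
     forall n, (nu n <= mu n * (1 + M / Num.sqrt alpha * kbar * eps n)%:E)%E).
Proof.
move=> Vh mu nu M L kbar.
have /choice[m mP] n := ritz_const_attained (mu_le n).
have /choice[Rh2 Rh2P] n : exists Rh2 : V2 -> V2, forall v2,
    Vh2 n (Rh2 v2) /\ forall v1, a v1 (Rh2 v2) = a (Rh1 n v1) v2.
  by have [_ _ _ best] := mP n; apply: adjoint_ritz best.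
have M0 : 0 <= M by rewrite le_max opnorm_ge0.
have sa0 : 0 < Num.sqrt alpha by rewrite sqrtr_gt0.
have IM v : `|I v| <= M * `|v|.
  by rewrite (le_trans (le_opnorm I_bounded v))// ler_wpM2r// le_max lexx.
have CsM v : `|Cs v| <= M * `|v|.
  by rewrite (le_trans (adjoint_bound CsP C_bounded v))// ler_wpM2r// le_max lexx orbT.
have kbar0 : 0 < kbar.
  have L0 : 0 <= L by rewrite divr_ge0// ltW.
  rewrite mulr_gt0 ?divr_gt0 ?ltr_wpDr ?mulr_ge0 ?addr_ge0 ?divr_ge0 ?mulr_ge0 ?(ltW sa0)//.
  exact: le_trans mubar_ge1.
pose E1 n := range (fun v => v - Rh1 n v).
pose E2 n := range (fun v => v - Rh2 n v).
(* The sum dominates both restricted norms, so it serves as the common bound in the discretization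
   estimate. *)
pose eta n := relnorm I (E1 n) + relnorm Cs (E2 n).
(* The estimate carries the factor [1 + m n <= 1 + mubar]; dividing by the positive constant [kbar]
   brings it into the stated form. *)
pose c := (1 + mubar) / kbar.
have nu_le n : (nu n <= mu n * (1 + M / Num.sqrt alpha * kbar * (c * eta n))%:E)%E.
  have [muE m1 m_le best] := mP n.
  have r1 : 0 <= relnorm I (E1 n) by exact: relnorm_ge0.
  have r2 : 0 <= relnorm Cs (E2 n) by exact: relnorm_ge0.
  have m0 : 0 <= m n by exact: le_trans m1.
  rewrite /mu muE -EFinM; apply: le_trans.
    apply: (discr_const_le (eta := eta n) a_bounded norm_V2 a_inj _ alpha_gt0 _
      IM CsM (Vh1_findim n) (Vh2_findim n) (Vh_nondeg n) (Rh1P n) M0 m0 best (Rh2P n) m1).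
    - exact: adjoint_sub CsP.
    - exact: metric_proj_firm K_convex PKP.
    - exact: addr_ge0.
    - move=> v; apply: (@le_trans _ _ (relnorm I (E1 n) * `|v - Rh1 n v|)).
        by apply: (le_relnorm IM); exists v.
      by rewrite ler_wpM2r// lerDl.
    - move=> v; apply: (@le_trans _ _ (relnorm Cs (E2 n) * `|v - Rh2 n v|)).
        by apply: (le_relnorm CsM); exists v.
      by rewrite ler_wpM2r// lerDr.
  rewrite lee_fin ler_wpM2l// lerD2l.
  have -> : M / Num.sqrt alpha * kbar * (c * eta n) =
      (1 + mubar) * (M / Num.sqrt alpha) * eta n.
    by rewrite /c; field; rewrite !gt_eqF.
  by rewrite ler_wpM2r ?addr_ge0// ler_wpM2r ?divr_ge0 ?(ltW sa0)// lerD2l.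
split=> [cI cC approx|d Om _ _ s1 s2 delta J1 J2 _ _ Q2 Q3 Q4].
  exists (fun n => c * eta n); split => //.
  rewrite -(mulr0 c) -(addr0 (0 : R)); apply: cvgMr; apply: cvgD.
    exact: (compact_ritz_error a_bounded norm_V2 a_inj).
  exact: (compact_adjoint_ritz_error a_bounded norm_V2 a_inj).
have [c1 [c10 c1P]] := sobolev_ritz_error a_bounded norm_V2 a_inj I_bounded Vh1_findim Vh2_findim Rh1P Q2 Q3 Q4.
have [c2 [c20 c2P]] := sobolev_adjoint_ritz_error a_bounded norm_V2 a_inj CsP Vh1_findim Vh2_findim Vh_nondeg Rh1P Rh2P Q2 Q3 Q4.
exists (fun n => c * eta n); split => //.
(* The [+ 1] makes the constant strictly positive. *)
apply/eqO_exP; exists (`|c| * (c1 + c2) + 1).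
  by rewrite ltr_wpDl// mulr_ge0// addr_ge0.
exists 0%N => // n _ /=.
have hd0 : 0 <= h n `^ delta by exact: powR_ge0.
have eta_le : eta n <= (c1 + c2) * h n `^ delta.
  rewrite mulrDl lerD ?relnorm_le ?mulr_ge0// => _ [v _ <-]; [exact: c1P|exact: c2P].
rewrite normrM (ger0_norm hd0) [`|eta n|]ger0_norm ?addr_ge0 ?relnorm_ge0//.
rewrite (le_trans (ler_wpM2l (normr_ge0 c) eta_le))// mulrA ler_wpM2r//.
by rewrite lerDl.
Qed.
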